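(* For $L>0$ and $\varepsilon>0$ let $$K_{L,\varepsilon}=\left\{(Lt,x,y)\in\mathbb R^3:\ 0\le t\le 1,\ |x|\le t,\ |y|\le\varepsilon\left(1-\frac{2t}{3}\right)\right\}.$$ For $L=1000$ and $\varepsilon=1/100$ one has $$\Delta(K_{L,\varepsilon})>\theta(K_{L,\varepsilon}).$$
   Context: For a convex body $K\subset\mathbb R^3$ (compact convex set with nonempty interior), $\Delta(K)=\mathbb E|X_1-X_2|$ where $X_1,X_2$ are independent and distributed according to normalized Lebesgue measure on $K$, and $\theta(K)=\mathbb E|B_1-B_2|$ where $B_1,B_2$ are independent and distributed according to normalized surface area measure ($2$-dimensional Hausdorff measure) on $\partial K$. $|\cdot|$ is the Euclidean norm. *)

(* Defs.v *)
From HB Require Import structures.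
From mathcomp Require Import all_boot all_order all_algebra.
From mathcomp Require Import all_classical all_reals all_analysis measurable_realfun.
From mathcomp Require Import ring lra.
Set Implicit Arguments.
Unset Strict Implicit.
Unset Printing Implicit Defensive.
Import Order.TTheory GRing.Theory Num.Theory.
Import numFieldNormedType.Exports.
Local Open Scope classical_set_scope.
Local Open Scope ring_scope.

(* Points are triples of reals, with the product Borel sigma-algebra, topology
   and vector space structure. The norm that the library puts on a product is
   the sup norm, hence the explicit Euclidean distance [edist] below. *)
Definition space3 (R : realType) : Type :=
  (measurableTypeR R * measurableTypeR R * measurableTypeR R)%type.
HB.instance Definition _ (R : realType) := Measurable.on (space3 R).

Section hausdorff.
Variable R : realType.
Implicit Types (A B : set (space3 R)) (p q : space3 R).

Definition edist (p q : space3 R) : R :=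
  Num.sqrt ((p.1.1 - q.1.1) ^+ 2 + (p.1.2 - q.1.2) ^+ 2 + (p.2 - q.2) ^+ 2).

Local Open Scope ereal_scope.

(* [ereal_sup set0] is [-oo], hence the extra 0, which makes [diam set0 = 0]. *)
Definition diam (A : set (space3 R)) : \bar R :=
  ereal_sup (0 |` [set (edist p q)%:E | p in A & q in A]).

(* The factor pi / 4 is the area of a disc of diameter 1. *)
Definition hausdorff2_pre (delta : R) (A : set (space3 R)) : \bar R :=
  ereal_inf [set \sum_(k <oo) (pi / 4)%:E * diam (U k) ^+ 2 |
    U in [set U : nat -> set (space3 R) |
      A `<=` \bigcup_k U k /\ forall k, diam (U k) <= delta%:E]].

Definition hausdorff2 (A : set (space3 R)) : \bar R :=
  ereal_sup [set hausdorff2_pre delta A | delta in [set delta | (0 < delta)%R]].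

Lemma edist_ge0 p q : (0 <= edist p q)%R.
Proof. exact: sqrtr_ge0. Qed.

Lemma diam_ge0 A : 0 <= diam A.
Proof. by apply: ereal_sup_ubound; left. Qed.

Lemma diam0 : diam set0 = 0.
Proof.
rewrite /diam (_ : _ |` _ = [set 0]) ?ereal_sup1//.
by apply/seteqP; split => x; [case=> // -[p []]|left].
Qed.

Lemma edist_diam (A : set (space3 R)) p q : A p -> A q -> (edist p q)%:E <= diam A.
Proof. by move=> Ap Aq; apply: ereal_sup_ubound; right; exists p => //; exists q. Qed.

Let cost (A : set (space3 R)) : \bar R := (pi / 4)%:E * diam A ^+ 2.

Let cost_ge0 A : 0 <= cost A.
Proof.
apply: mule_ge0; last exact/expe_ge0/diam_ge0.
by rewrite lee_fin divr_ge0// pi_ge0.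
Qed.

Let cost0 : cost set0 = 0.
Proof. by rewrite /cost diam0 expe2 !mule0. Qed.

(* [mu_ext] only ranges over measurable covers, hence the discrete
   sigma-algebra. *)
Let discr := g_sigma_algebraType [set: set (space3 R)].

Let gauge (delta : R) (A : set discr) : \bar R :=
  if diam A <= delta%:E then cost A else +oo.

Let gauge_ge0 delta A : 0 <= gauge delta A.
Proof. by rewrite /gauge; case: ifP. Qed.

Let gauge0 delta : (0 < delta)%R -> gauge delta set0 = 0.
Proof. by move=> d0; rewrite /gauge diam0 lee_fin ltW// cost0. Qed.

Let hausdorff2_preE delta A : hausdorff2_pre delta A = mu_ext (gauge delta) A.
Proof.
apply/eqP; rewrite eq_le; apply/andP; split.
- apply: le_ereal_inf_tmp => _ [F [_ AF] <-].
  have [[k Fk]|Fdelta] := pselect (exists k, ~~ (diam (F k) <= delta%:E)).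
    by rewrite (@eseries_pinfty _ _ _ k) ?leey// ?/gauge ?(negbTE Fk)// => n _;
       rewrite gt_eqF// (lt_le_trans _ (gauge_ge0 _ _)).
  have {}Fdelta k : diam (F k) <= delta%:E.
    by apply: contrapT => /negP Fk; apply: Fdelta; exists k.
  apply: ereal_inf_lbound; exists F => //.
  by apply: eq_eseriesr => k _; rewrite /gauge Fdelta.
- apply: le_ereal_inf_tmp => _ [F [AF Fdelta] <-].
  apply: ereal_inf_lbound; exists F.
    by split => // k; exact: sub_sigma_algebra.
  by apply: eq_eseriesr => k _; rewrite /gauge Fdelta.
Qed.

Lemma hausdorff2_pre_ge0 delta A : 0 <= hausdorff2_pre delta A.
Proof. by rewrite hausdorff2_preE; apply: mu_ext_ge0. Qed.

Lemma hausdorff2_pre0 delta : (0 < delta)%R -> hausdorff2_pre delta set0 = 0.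
Proof. by move=> d0; rewrite hausdorff2_preE mu_ext0//; exact: gauge0. Qed.

Lemma le_premeas delta A B : A `<=` B -> hausdorff2_pre delta A <= hausdorff2_pre delta B.
Proof. by move=> AB; rewrite !hausdorff2_preE; exact: le_mu_ext. Qed.

Lemma hausdorff2_pre_sigma_subadditive delta : sigma_subadditive (hausdorff2_pre delta).
Proof.
move=> F; rewrite hausdorff2_preE; under eq_eseriesr do rewrite hausdorff2_preE.
exact: mu_ext_sigma_subadditive.
Qed.

Lemma hausdorff2_pre_le_hausdorff2 delta A : (0 < delta)%R -> hausdorff2_pre delta A <= hausdorff2 A.
Proof. by move=> d0; apply: ereal_sup_ubound; exists delta. Qed.

Lemma hausdorff2_pre_anti d1 d2 A : (d1 <= d2)%R -> hausdorff2_pre d2 A <= hausdorff2_pre d1 A.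
Proof.
move=> d12; apply: ereal_inf_le_tmp => _ [F [AF Fd] <-]; exists F => //.
by split => // k; rewrite (le_trans (Fd k)).
Qed.

Lemma hausdorff2_ge0 A : 0 <= hausdorff2 A.
Proof. exact: le_trans (hausdorff2_pre_ge0 1 A) (hausdorff2_pre_le_hausdorff2 _ ltr01). Qed.

Lemma hausdorff2_set0 : hausdorff2 set0 = 0.
Proof.
apply/eqP; rewrite eq_le hausdorff2_ge0 andbT.
by apply: ge_ereal_sup => _ [d d0 <-]; rewrite hausdorff2_pre0.
Qed.

Lemma le_hausdorff2 : {homo hausdorff2 : A B / A `<=` B >-> A <= B}.
Proof.
move=> A B AB; apply: ge_ereal_sup => _ [d d0 <-].
exact: le_trans (le_premeas _ AB) (hausdorff2_pre_le_hausdorff2 _ d0).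
Qed.

Lemma hausdorff2_sigma_subadditive : sigma_subadditive hausdorff2.
Proof.
move=> F; apply: ge_ereal_sup => _ [d d0 <-].
apply: le_trans (hausdorff2_pre_sigma_subadditive _ _) _.
apply: lee_nneseries => [k _ _|k _]; first exact: hausdorff2_pre_ge0.
exact: hausdorff2_pre_le_hausdorff2.
Qed.

HB.instance Definition _ := isOuterMeasure.Build R (space3 R) hausdorff2
  hausdorff2_set0 hausdorff2_ge0 le_hausdorff2 hausdorff2_sigma_subadditive.

Lemma hausdorff2_pre_separated (d : R) (A B : set (space3 R)) :
    (forall a b, A a -> B b -> (d < edist a b)%R) ->
  hausdorff2_pre d A + hausdorff2_pre d B <= hausdorff2_pre d (A `|` B).
Proof.
move=> AB; apply: le_ereal_inf_tmp => _ [F [ABF Fd] <-].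
pose G C k := if pselect (F k `&` C !=set0) then F k else set0.
have Gd C k : diam (G C k) <= d%:E.
  rewrite /G; case: pselect => [?|_] /=; first exact: Fd.
  rewrite diam0.
  exact: (le_trans (diam_ge0 (F k)) (Fd k)).
have cover (C : set (space3 R)) : C `<=` A `|` B -> C `<=` \bigcup_k G C k.
  move=> CAB x Cx; have [k _ Fkx] := ABF _ (CAB _ Cx).
  by exists k => //; rewrite /G; case: pselect => //; case; exists x.
have pre (C : set (space3 R)) : C `<=` A `|` B -> hausdorff2_pre d C <= \sum_(k <oo) cost (G C k).
  by move=> CAB; apply: ereal_inf_lbound; exists (G C) => //; split => //; exact: cover.
apply: (@le_trans _ _ (\sum_(k <oo) cost (G A k) + \sum_(k <oo) cost (G B k))).
  by apply: leeD; apply: pre => x; [left|right].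
rewrite -nneseriesD//; apply: lee_nneseries => [k _ _|k _]; first exact: adde_ge0.
rewrite /G; case: pselect => [FA|nFA]; case: pselect => [FB|nFB] /=;
  rewrite ?cost0 ?adde0 ?add0e ?cost_ge0//.
move: FA FB => [a [Fa Aa]] [b [Fb Bb]].
have := le_trans (edist_diam Fa Fb) (Fd k).
by rewrite lee_fin leNgt AB.
Qed.

Lemma hausdorff2_separated (d : R) (A B : set (space3 R)) : (0 < d)%R ->
    (forall a b, A a -> B b -> (d <= edist a b)%R) ->
  hausdorff2 A + hausdorff2 B <= hausdorff2 (A `|` B).
Proof.
move=> d0 AB.
have pre d1 d2 : (0 < d1)%R -> (0 < d2)%R ->
    hausdorff2_pre d1 A + hausdorff2_pre d2 B <= hausdorff2 (A `|` B).
  move=> d10 d20; pose e : R := Num.min (d / 2)%R (Num.min d1 d2).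
  have e0 : (0 < e)%R by rewrite !lt_min d10 d20 divr_gt0.
  apply: (@le_trans _ _ (hausdorff2_pre e A + hausdorff2_pre e B)).
    by apply: leeD; apply: hausdorff2_pre_anti; rewrite !ge_min lexx ?orbT.
  apply: le_trans (hausdorff2_pre_le_hausdorff2 _ e0); apply: hausdorff2_pre_separated => a b Aa Bb.
  apply: lt_le_trans (AB _ _ Aa Bb); rewrite gt_min.
  by rewrite ltr_pdivrMr// ltr_pMr// ltr1n.
have [->|] := eqVneq (hausdorff2 (A `|` B)) +oo; first by rewrite leey.
rewrite -ltey => ABoo.
have fin x : 0 <= x -> x <= hausdorff2 (A `|` B) -> x \is a fin_num.
  by move=> x0 xAB; rewrite ge0_fin_numE// (le_lt_trans xAB).
have hB : hausdorff2 B \is a fin_num.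
  by apply: fin; [exact: hausdorff2_ge0|apply: le_hausdorff2 => x; right].
rewrite -leeBrDr//; apply: ge_ereal_sup => _ [d1 d10 <-].
have hA : hausdorff2_pre d1 A \is a fin_num.
  apply: fin; first exact: hausdorff2_pre_ge0.
  by apply: (le_trans (hausdorff2_pre_le_hausdorff2 _ d10)); apply: le_hausdorff2 => x; left.
rewrite leeBrDr// addeC -leeBrDr//; apply: ge_ereal_sup => _ [d2 d20 <-].
by rewrite leeBrDr// addeC pre.
Qed.

Let caratheodory_gt (f : space3 R -> R) (a : R) :
  (forall p q, (f p - f q <= edist p q)%R) ->
  hausdorff2.-caratheodory [set p | (a < f p)%R].
Proof.
move=> flip; apply: le_caratheodory_measurable => X.
set G := [set p | (a < f p)%R].
change (hausdorff2 (X `&` G) + hausdorff2 (X `&` ~` G) <= hausdorff2 X).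
have [->|] := eqVneq (hausdorff2 X) +oo; first by rewrite leey.
rewrite -ltey => Xoo.
pose c k : R := (a + k.+1%:R^-1)%R.
have c_decr k : (c k.+1 < c k)%R.
  by rewrite ltrD2l ltf_pV2 ?posrE// ltr_nat.
have ac k : (a < c k)%R by rewrite ltrDl invr_gt0.
pose D k : set (space3 R) := X `&` [set p | (c k.+1 <= f p < c k)%R].
pose B k : set (space3 R) := X `&` [set p | (c k <= f p)%R].
pose E k := if k is k'.+1 then B k' else set0.
have BX k : hausdorff2 (B k) <= hausdorff2 X by apply: le_hausdorff2 => p [].
have EX k : hausdorff2 (E k) <= hausdorff2 X by apply: le_hausdorff2; case: k => //= k p [].
have ED k : hausdorff2 (E k) + hausdorff2 (D k) <= hausdorff2 (E k.+2).
  case: k => [|k] /=.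
    by rewrite hausdorff2_set0 add0e; apply: le_hausdorff2 => p [Xp /= /andP[? _]].
  apply: (@le_trans _ _ (hausdorff2 (B k `|` D k.+1))).
    apply: (@hausdorff2_separated (c k - c k.+1)); first by rewrite subr_gt0.
    move=> p q [_ /= cp] [_ /= /andP[_ qc]].
    by apply: le_trans (flip p q); rewrite lerB// ltW.
  apply: le_hausdorff2 => p [[Xp /= cp]|[Xp /= /andP[cp _]]]; split => //=.
  by rewrite (le_trans _ cp)// (le_trans (ltW (c_decr _)))// ltW.
have sumD n : \sum_(0 <= k < n) hausdorff2 (D k) <= hausdorff2 (E n.+1) + hausdorff2 (E n).
  elim: n => [|n IH]; first by rewrite big_geq// adde_ge0// hausdorff2_ge0.
  rewrite big_nat_recr//= (le_trans (leeD2r _ IH))// -addeA addeC.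
  by rewrite leeD2r// ED.
have sumDoo : \sum_(0 <= k <oo) hausdorff2 (D k) < +oo.
  apply: (@le_lt_trans _ _ (hausdorff2 X + hausdorff2 X)); last exact: lte_add_pinfty.
  apply: lime_le; first by apply: is_cvg_nneseries => *; exact: hausdorff2_ge0.
  by apply: nearW => n; apply: (le_trans (sumD n)); exact: leeD.
have XG n : hausdorff2 (X `&` G) <=
    hausdorff2 (B n) + \sum_(n <= k <oo) hausdorff2 (D k).
  apply: (@le_trans _ _ (hausdorff2 (B n `|` \bigcup_(k in ~` `I_n) D k))).
    apply: le_hausdorff2 => p [Xp /= ap].
    have [cp|pc] := leP (c n) (f p); [by left|right].
    have exk : exists k, (c k <= f p)%R.
      exists (Num.truncn (f p - a)^-1).
      rewrite /c -lerBrDl -[leRHS]invrK lef_pV2 ?posrE ?invr_gt0 ?subr_gt0//.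
      by rewrite ltW// truncnS_gt.
    case: (ex_minnP exk) => k cp mink.
    have nk : (n < k)%N.
      rewrite ltnNge; apply/negP => kn; move: pc; rewrite ltNge => /negP; apply.
      apply: le_trans cp; rewrite lerD2l lef_pV2 ?posrE// ler_nat.
      exact: kn.
    case: k nk cp mink => // k nk cp mink; exists k.
      by apply/negP; rewrite -leqNgt.
    split => //=; rewrite cp/= ltNge; apply/negP => /mink.
    by rewrite ltnn.
  apply: (le_trans (outer_measureU2 _ _ _)); apply: leeD2l.
  exact: outer_measure_sigma_subadditive_tail.
have BG n : hausdorff2 (B n) + hausdorff2 (X `&` ~` G) <= hausdorff2 X.
  apply: (@le_trans _ _ (hausdorff2 (B n `|` X `&` ~` G))).
    apply: (@hausdorff2_separated (c n - a)); first by rewrite subr_gt0.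
    move=> p q [_ /= cp] [_ /= /negP]; rewrite -leNgt => qa.
    by apply: le_trans (flip p q); rewrite lerB.
  by apply: le_hausdorff2 => p [[]|[]].
apply/lee_addgt0Pr => e e0.
have /fine_cvgP[Sfin /cvgrPdist_lt/(_ e e0) Se] :
    \sum_(n <= k <oo) hausdorff2 (D k) @[n --> \oo] --> 0.
  by apply: nneseries_tail_cvg => // k _; exact: hausdorff2_ge0.
near \oo => N.
have SN : \sum_(N <= k <oo) hausdorff2 (D k) <= e%:E.
  rewrite -[leLHS]fineK; last by near: N.
  rewrite lee_fin (le_trans (ler_norm _))// ltW// -normrN -sub0r.
  by near: N.
apply: (le_trans (leeD2r _ (XG N))); rewrite addeAC.
exact: leeD.
Unshelve. all: by end_near. Qed.

Let measurable_id_cara :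
  measurable_fun [set: caratheodory_type hausdorff2] (id : caratheodory_type hausdorff2 -> space3 R).
Proof.
have lip (f : space3 R -> R) : (forall p q, (f p - f q <= edist p q)%R) ->
    measurable_fun [set: caratheodory_type hausdorff2] (f : _ -> measurableTypeR R).
  move=> fl; apply: (measurability (@RGenOInfty.G R)).
    exact: RGenOInfty.measurableE.
  move=> _ [_ [a ->] <-]; rewrite setTI.
  rewrite (_ : _ @^-1` _ = [set p | (a < f p)%R]); first exact: caratheodory_gt.
  by apply/seteqP; split => p /=; rewrite in_itv/= andbT.
have le_sqrt (x y : R) : (x ^+ 2 <= y -> x <= Num.sqrt y)%R.
  move=> xy; rewrite (le_trans (ler_norm x))// -sqrtr_sqr ler_sqrt//.
  exact: le_trans (sqr_ge0 x) xy.
have m11 : measurable_fun [set: caratheodory_type hausdorff2] (fun p : space3 R => p.1.1).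
  by apply: lip => p q; apply: le_sqrt; rewrite -addrA lerDl addr_ge0// sqr_ge0.
have m12 : measurable_fun [set: caratheodory_type hausdorff2] (fun p : space3 R => p.1.2).
  by apply: lip => p q; apply: le_sqrt; rewrite addrAC lerDr addr_ge0// sqr_ge0.
have m2 : measurable_fun [set: caratheodory_type hausdorff2] (fun p : space3 R => p.2).
  by apply: lip => p q; apply: le_sqrt; rewrite lerDr addr_ge0// sqr_ge0.
rewrite (_ : id = fun p => ((p.1.1, p.1.2), p.2)).
  have m1 := measurable_fun_pair m11 m12.
  exact: (measurable_fun_pair m1 m2).
by apply/funext => -[[]].
Qed.

Lemma hausdorff2_caratheodory (A : set (space3 R)) :
  measurable A -> hausdorff2.-caratheodory A.
Proof.
move=> mA; have := measurable_id_cara measurableT mA.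
by rewrite setTI.
Qed.

Lemma hausdorff2_semi_sigma_additive : semi_sigma_additive hausdorff2.
Proof.
move=> F mF tF mUF.
apply: (@caratheodory_measure_sigma_additive R (space3 R) hausdorff2) => //.
  by move=> k; exact: hausdorff2_caratheodory.
exact: hausdorff2_caratheodory.
Qed.

HB.instance Definition _ := isMeasure.Build _ (space3 R) R hausdorff2
  hausdorff2_set0 hausdorff2_ge0 hausdorff2_semi_sigma_additive.

End hausdorff.

Section bodies.
Variable R : realType.

Lemma open_measurable3 (U : set (space3 R)) : open U -> measurable U.
Proof.
move=> oU.
pose box (q : rat * rat * rat * rat) : set (space3 R) :=
  (ball (ratr q.1.1.1 : R) (ratr q.2 : R) `*` ball (ratr q.1.1.2 : R) (ratr q.2 : R))
    `*` ball (ratr q.1.2 : R) (ratr q.2 : R).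
pose F q := if pselect (box q `<=` U) then box q else set0.
have -> : U = \bigcup_q F q.
  apply/seteqP; split => [p Up|p [q _]]; last first.
    by rewrite /F; case: pselect => //= qU; exact: qU.
  have /nbhs_ballP[e /= e0 eU] : nbhs p U by apply: open_nbhs_nbhs.
  have [r /andP[]] : exists r : rat, ((0:R) < ratr r) && ((ratr r : R) < e / 2).
    have : ((0:R) < e / 2) by rewrite divr_gt0.
    by move=> /rat_in_itvoo[r]; rewrite in_itv/=; exists r.
  move=> r0 re.
  have near_rat (x : R) : exists a : rat, ball (ratr a : R) (ratr r : R) x.
    have : (x - ratr r < x + ratr r) by lra.
    move=> /rat_in_itvoo[a]; rewrite in_itv/= => /andP[ax xa].
    by exists a; rewrite -ball_normE /= ltr_norml; lra.
  have [a pa] := near_rat p.1.1.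
  have [b pb] := near_rat p.1.2.
  have [c pc] := near_rat p.2.
  have boxp : box (a, b, c, r) p by [].
  have near2 (x y z : R) : ball x (ratr r : R) y -> ball x (ratr r : R) z -> ball y e z.
    by rewrite -!ball_normE /= !ltr_norml; lra.
  have boxU : box (a, b, c, r) `<=` U.
    move=> p' [[/= pa' pb'] pc']; apply: eU; split; [split|].
    - exact: near2 pa pa'.
    - exact: near2 pb pb'.
    - exact: near2 pc pc'.
  by exists (a, b, c, r) => //; rewrite /F; case: pselect.
apply: countable_bigcupT_measurable => [|q]; first exact: countableP.
rewrite /F; case: pselect => //= _.
by apply: measurableX; [apply: measurableX|]; exact: measurable_ball.
Qed.

Lemma closed_measurable3 (A : set (space3 R)) : closed A -> measurable A.
Proof.
move=> cA; rewrite -[A]setCK; apply: measurableC.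
by apply: open_measurable3; exact: closed_openC.
Qed.

Definition boundary (A : set (space3 R)) : set (space3 R) := closure A `\` A°.

Lemma closed_boundary A : closed (boundary A).
Proof.
rewrite /boundary setDE; apply: closedI; first exact: closed_closure.
apply: open_closedC; exact: open_interior.
Qed.

Record convex_body := ConvexBody {
  body :> set (space3 R);
  body_compact : compact body;
  body_convex : convex_set body;
  body_interior : body° !=set0 }.

Lemma measurable_body (K : convex_body) : measurable (K : set (space3 R)).
Proof.
apply: closed_measurable3; apply: compact_closed; last exact: body_compact.
exact: norm_hausdorff.
Qed.

Lemma measurable_boundary (K : convex_body) : measurable (boundary K).
Proof. by apply: closed_measurable3; exact: closed_boundary. Qed.

Definition lebesgue3 : set (space3 R) -> \bar R :=
  (@lebesgue_measure R \x @lebesgue_measure R \x @lebesgue_measure R)%E.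

HB.instance Definition _ := Measure.on lebesgue3.

(* [mnormalize] divides by the total mass of the restriction of [mu] to [D];
   the Dirac mass only serves as its default value when [mu D] is 0 or +oo,
   which happens neither for the volume nor for the surface of a convex body. *)
Definition uniform_on (mu : {measure set (space3 R) -> \bar R})
    (D : set (space3 R)) (mD : measurable D) : probability (space3 R) R :=
  mnormalize (mrestr mu mD) (dirac point).

(* The mean distance of two independent points of law [P]: their joint law is
   the product measure. *)
Definition mean_distance (P : probability (space3 R) R) : \bar R :=
  'E_(P \x P)%E[fun p => edist p.1 p.2].

Definition Delta (K : convex_body) : \bar R :=
  mean_distance (uniform_on lebesgue3 (measurable_body K)).

Definition theta (K : convex_body) : \bar R :=
  mean_distance (uniform_on (@hausdorff2 R) (measurable_boundary K)).

Definition Kset (L e : R) : set (space3 R) :=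
  [set p | exists t x y : R, p = (L * t, x, y) /\
    [/\ 0 <= t <= 1, `|x| <= t & `|y| <= e * (1 - 2 * t / 3)]].

Let for_continuous_pair (T U V : topologicalType) (f : T -> U) (g : T -> V) x :
  {for x, continuous f} -> {for x, continuous g} ->
  {for x, continuous (fun y => (f y, g y))}.
Proof. by move=> cf cg; exact: (cvg_pair cf cg). Qed.

Lemma Kset_compact L e : 0 < L -> 0 < e -> compact (Kset L e).
Proof.
move=> L0 e0.
pose g (q : R * R * R) : space3 R := (L * q.1.1, q.1.1 * q.1.2, e * (1 - 2 * q.1.1 / 3) * q.2).
have -> : Kset L e = g @` (`[0, 1] `*` `[-1, 1] `*` `[-1, 1]).
  apply/seteqP; split => [p kp|p gp].
    case: kp => t [x [y [-> [/andP[t0 t1] xt yt]]]].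
    have s0 : 0 < e * (1 - 2 * t / 3) by apply: mulr_gt0 => //; lra.
    exists (t, x / t, y / (e * (1 - 2 * t / 3))); last first.
      rewrite /g/=; congr (_, _, _); last by rewrite mulrC divfK// gt_eqF.
      have [t00|tn0] := eqVneq t 0; last by rewrite mulrC divfK.
      by move: xt; rewrite t00 normr_le0 mul0r => /eqP ->.
    split => /=; [split|] => /=; rewrite in_itv/=.
    - by rewrite t0.
    - rewrite -ler_norml normrM normfV (ger0_norm t0).
      have [->|tn0] := eqVneq t 0; first by rewrite invr0 mulr0.
      by rewrite ler_pdivrMr ?mul1r// lt0r tn0.
    - rewrite -ler_norml normrM normfV (gtr0_norm s0).
      by rewrite ler_pdivrMr ?mul1r.
  case: gp => -[[t u] v] /= [[]].
  rewrite !in_itv/= => /andP[t0 t1]; rewrite -!ler_norml => u1 v1 <-.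
  have s0 : 0 < e * (1 - 2 * t / 3) by apply: mulr_gt0 => //; lra.
  exists t, (t * u), (e * (1 - 2 * t / 3) * v); split => //; split; first by rewrite t0.
  - by rewrite normrM (ger0_norm t0) ler_piMr.
  - by rewrite normrM (gtr0_norm s0) ler_piMr// ltW.
apply: continuous_compact; last first.
  by apply: compact_setX; [apply: compact_setX|]; exact: segment_compact.
apply: continuous_subspaceT => q.
have c11 : {for q, continuous (fun q : R * R * R => q.1.1)}.
  by apply: continuous_comp; exact: cvg_fst.
have c12 : {for q, continuous (fun q : R * R * R => q.1.2)}.
  by apply: continuous_comp; [exact: cvg_fst|exact: cvg_snd].
have c2 : {for q, continuous (fun q : R * R * R => q.2)} by exact: cvg_snd.
apply: (@for_continuous_pair _ (R * R)%type R
  (fun q : R * R * R => (L * q.1.1, q.1.1 * q.1.2))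
  (fun q : R * R * R => e * (1 - 2 * q.1.1 / 3) * q.2)).
  apply: for_continuous_pair.
    by apply: cvgM => //; exact: cvg_cst.
  exact: cvgM.
apply: cvgM => //; apply: cvgM; first exact: cvg_cst.
  apply: cvgB; first exact: cvg_cst.
  by apply: cvgM; [apply: cvgM => //|]; exact: cvg_cst.
Qed.

Lemma Kset_convex L e : convex_set (Kset L e).
Proof.
move=> p q l /set_mem[t [x [y [-> [/andP[t0 t1] xt yt]]]]].
move=> /set_mem[t' [x' [y' [-> [/andP[t0' t1'] xt' yt']]]]].
apply/mem_set.
have l0 : 0 <= l%:num by [].
have l1 : l%:num <= 1 by [].
rewrite /conv/= /unstable.onem.
move: (l%:num) l0 l1 => a a0 a1.
have b0 : 0 <= 1 - a by rewrite subr_ge0.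
have comb (u v u' v' : R) : `|u| <= v -> `|u'| <= v' ->
    `|a * u + (1 - a) * u'| <= a * v + (1 - a) * v'.
  move=> uv uv'; rewrite (le_trans (ler_normD _ _))// !normrM.
  by rewrite (ger0_norm a0) (ger0_norm b0) lerD// ler_wpM2l.
exists (a * t + (1 - a) * t'), (a * x + (1 - a) * x'), (a * y + (1 - a) * y').
split.
  change ((a * (L * t) + (1 - a) * (L * t'), a * x + (1 - a) * x',
    a * y + (1 - a) * y') = (L * (a * t + (1 - a) * t'), a * x + (1 - a) * x',
    a * y + (1 - a) * y') :> R * R * R).
  by congr (_, _, _); ring.
split; [apply/andP; split|exact: comb|].
- by rewrite addr_ge0 ?mulr_ge0.
- have := ler_wpM2l a0 t1; have := ler_wpM2l b0 t1'; lra.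
- have -> : e * (1 - 2 * (a * t + (1 - a) * t') / 3) =
    a * (e * (1 - 2 * t / 3)) + (1 - a) * (e * (1 - 2 * t' / 3)) by field.
  exact: comb.
Qed.

Lemma Kset_interior L e : 0 < L -> 0 < e -> (Kset L e)° !=set0.
Proof.
move=> L0 e0; exists ((L / 2, 0, 0) : space3 R).
pose d := Num.min (L / 4) (Num.min 4^-1 (e / 4)).
have d0 : 0 < d by rewrite !lt_min; apply/and3P; split; lra.
apply/nbhs_ballP; exists d => //= -[[x y] z].
have : [/\ d <= L / 4, d <= 4^-1 & d <= e / 4].
  by split; rewrite !ge_min lexx ?orbT.
move: d d0 => d d0 [dL d4 de] [[/= hx hy] hz].
move: hx hy hz; rewrite -!ball_normE/= !sub0r !normrN.
rewrite ltr_norml => /andP[hx1 hx2] hy hz.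
have LN : L != 0 by rewrite gt_eqF.
have xL : 4^-1 <= x / L <= 3 / 4.
  by rewrite ler_pdivlMr// ler_pdivrMr//; apply/andP; split; lra.
exists (x / L), y, z; split; first by rewrite mulrC divfK.
move: xL => /andP[x1 x2]; split; [lra|lra|].
have : e * (1 / 2) <= e * (1 - 2 * (x / L) / 3) by rewrite ler_pM2l//; lra.
lra.
Qed.

Definition K_body (L e : R) (L0 : 0 < L) (e0 : 0 < e) : convex_body :=
  ConvexBody (Kset_compact L0 e0) (@Kset_convex L e) (Kset_interior L0 e0).

End bodies.

(* Main.v *)
From Pilot Require Import Defs.
From HB Require Import structures.
From mathcomp Require Import all_boot all_order all_algebra.
From mathcomp Require Import all_classical all_reals all_analysis.
From mathcomp Require Import measurable_realfun ring lra.
Import Order.TTheory GRing.Theory Num.Theory.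
Import numFieldNormedType.Exports.
(* MathComp-Analysis also has an [edist], which would shadow the Euclidean one. *)
Import Pilot.Defs.
Local Open Scope classical_set_scope.
Local Open Scope ring_scope.
Set Implicit Arguments.
Unset Strict Implicit.
Unset Printing Implicit Defensive.

(** Only the long coordinate s in [0, 1000] matters. For a law P and a real
    function f, E|f(X) - f(Y)| is twice the integral of P(f <= u) P(f > u), so
    the volume of the slabs {s <= u} gives Delta >= 281, while theta exceeds the
    mean distance of the s-coordinates by at most 2.02, the width plus the
    thickness of the body, so that upper bounds for the surface of the slabs and
    a lower bound for the total surface suffice.

    Every face is the image of a region of the plane z = 0 under a map with
    Lipschitz constant at most 1001/1000, and conversely the two large faces
    project onto the triangle |x| <= s/1000. On that plane the Hausdorff measure
    is translation invariant, hence a constant c times Lebesgue measure; the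
    value of c is irrelevant since the surface law is normalized. If the total
    surface were 0 or +oo, that law would be a Dirac mass by convention and
    theta would vanish, so one may assume that c is positive and finite. *)

(** * Hausdorff measure and Lipschitz maps *)

Section lipschitz.
Local Open Scope ereal_scope.
Context {R : realType}.
Implicit Types (A B : set (space3 R)) (f : space3 R -> space3 R).

Lemma diam_lipschitz (k : R) f A : (0 <= k)%R ->
    (forall p q, A p -> A q -> (edist (f p) (f q) <= k * edist p q)%R) ->
  diam (f @` A) <= k%:E * diam A.
Proof.
move=> k0 fk; apply: ge_ereal_sup => z [->|].
  by rewrite mule_ge0 ?diam_ge0.
move=> [x [p Ap xE] [y [q Aq yE] zE]]; rewrite -zE -xE -yE.
apply: (@le_trans _ _ (k * edist p q)%:E); first by rewrite lee_fin fk.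
by rewrite EFinM lee_wpmul2l ?lee_fin// edist_diam.
Qed.

(** A cover of [A] by sets of diameter at most [d / k] is carried by [f] to a cover of [B] by sets
    of diameter at most [d], at no more than [k ^+ 2] times the cost. *)
Lemma hausdorff2_lipschitz (k : R) f A B : (0 < k)%R ->
    (forall p q, A p -> A q -> (edist (f p) (f q) <= k * edist p q)%R) ->
    B `<=` f @` A ->
  hausdorff2 B <= (k ^+ 2)%:E * hausdorff2 A.
Proof.
move=> k0 fk BA; apply: ge_ereal_sup => _ [d /= d0 <-].
apply: (@le_trans _ _ ((k ^+ 2)%:E * hausdorff2_pre (d / k) A)); last first.
  by rewrite lee_wpmul2l ?lee_fin ?sqr_ge0// hausdorff2_pre_le_hausdorff2// divr_gt0.
rewrite -lee_pdivrMl ?exprn_gt0//; apply: le_ereal_inf_tmp => _ [U [AU Ud] <-].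
rewrite lee_pdivrMl ?exprn_gt0//.
(* The Lipschitz bound is available on [A] only, so the covering sets are first cut down to [A]. *)
pose V n := f @` (U n `&` A).
have Vk n : diam (V n) <= k%:E * diam (U n).
  apply: (@le_trans _ _ (k%:E * diam (U n `&` A))).
    by apply: diam_lipschitz (ltW k0) _ => p q [_ Ap] [_ Aq]; exact: fk.
  rewrite lee_wpmul2l ?lee_fin ?(ltW k0)//.
  apply: ge_ereal_sup => _ [->|[p [Up _] [q [Uq _] <-]]]; first exact: diam_ge0.
  exact: edist_diam.
apply: (@le_trans _ _ (\sum_(n <oo) (pi / 4)%:E * diam (V n) ^+ 2)).
  apply: ereal_inf_lbound; exists V => //; split.
    by move=> _ /BA[p Ap <-]; have [n _ Unp] := AU _ Ap; exists n => //; exists p.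
  move=> n; apply: (le_trans (Vk n)).
  by rewrite -lee_pdivlMl// -EFinM mulrC.
have p4 : (0 <= pi / 4 :> R)%R by rewrite divr_ge0// pi_ge0.
rewrite -nneseriesZl; last first.
  by move=> n _; rewrite mule_ge0// ?lee_fin// expe_ge0// diam_ge0.
apply: lee_nneseries => n _.
  by move=> _; rewrite mule_ge0// ?lee_fin// expe_ge0// diam_ge0.
rewrite [leRHS]muleCA lee_wpmul2l ?lee_fin// EFin_expe !expe2 muleACA.
by rewrite lee_pmul ?diam_ge0.
Qed.

Lemma hausdorff2_nonexpansive f A B :
    (forall p q, A p -> A q -> (edist (f p) (f q) <= edist p q)%R) -> B `<=` f @` A ->
  hausdorff2 B <= hausdorff2 A.
Proof.
move=> fle BA; have := @hausdorff2_lipschitz 1 f A B ltr01.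
rewrite expr1n mul1e; apply => // p q Ap Aq.
by rewrite mul1r fle.
Qed.

End lipschitz.

(** * Translation invariant measures on the plane *)

Lemma measurable_preimage d d' (S : measurableType d) (T : measurableType d')
  (f : S -> T) (A : set T) : measurable_fun setT f -> measurable A -> measurable (f @^-1` A).
Proof. by move=> mf mA; rewrite -[_ @^-1` _]setTI; exact: mf. Qed.

Section fubini_sections.
Local Open Scope ereal_scope.
Context d1 d2 (T1 : measurableType d1) (T2 : measurableType d2) (R : realType).
Variables (m1 : {sigma_finite_measure set T1 -> \bar R}).
Variables (m2 : {sigma_finite_measure set T2 -> \bar R}).

(** Tonelli's theorem for the indicator of [A]. *)
Lemma integral_section_swap (A : set (T1 * T2)) : measurable A ->
  \int[m1]_x m2 (xsection A x) = \int[m2]_y m1 (ysection A y).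
Proof.
move=> mA; have := indic_fubini_tonelli m1 m2 mA.
rewrite (indic_fubini_tonelli_FE m2 mA).
by rewrite (indic_fubini_tonelli_GE m1 mA).
Qed.

End fubini_sections.

(** Named so that it can carry a sigma-finite structure; [lebesgue3] is its product with
    [lebesgue_measure]. *)
Definition lebesgue2 {R : realType} : set (measurableTypeR R * measurableTypeR R) -> \bar R :=
  (@lebesgue_measure R \x @lebesgue_measure R)%E.
HB.instance Definition _ (R : realType) := Measure.on (@lebesgue2 R).

Lemma lebesgue2_sigma_finite (R : realType) : sigma_finite setT (@lebesgue2 R).
Proof.
pose F (n : nat) : set (measurableTypeR R) := `[- n%:R, n%:R]%classic.
exists (fun n => F n `*` F n).
  apply/seteqP; split => [[x y] _|//].
  exists (Num.truncn (`|x| + `|y|)).+1 => //=.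
  have := truncnS_gt (`|x| + `|y|).
  by split; rewrite /F /= in_itv/= -ler_norml;
    have := normr_ge0 x; have := normr_ge0 y; lra.
have mF n : measurable (F n) by exact: measurable_itv.
move=> n; split; first exact: measurableX.
rewrite /lebesgue2 product_measure1E//= lebesgue_measure_itv/=.
by case: ifP => _; rewrite -?EFinB -?EFinM ltry.
Qed.

HB.instance Definition _ (R : realType) := Measure_isSigmaFinite.Build _ _ _
  (@lebesgue2 R) (@lebesgue2_sigma_finite R).

Section translation_invariance.
Context {R : realType}.
Local Notation plane := (measurableTypeR R * measurableTypeR R)%type.
Implicit Types (A B : set plane) (p q v : plane).

Definition translate v : plane -> plane := fun p => p + v.

Definition translation_invariant (m : set plane -> \bar R) :=
  forall v A, measurable A -> m (translate v @^-1` A) = m A.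

Lemma measurable_addr (a : R) :
  measurable_fun setT (fun x : measurableTypeR R => x + a : measurableTypeR R).
Proof. exact: measurable_funD. Qed.

(** Lebesgue measure is characterised by its values on the intervals []x, y]], and its pushforward
    under a translation takes the same values there. *)
Lemma lebesgue_measure_translate (a : R) (A : set (measurableTypeR R)) :
  measurable A -> lebesgue_measure ((fun x : R => x + a) @^-1` A) = lebesgue_measure A.
Proof.
move=> mA; apply/esym.
pose f (x : measurableTypeR R) : measurableTypeR R := x + a.
pose m : {measure set (measurableTypeR R) -> \bar R} :=
  pushforward lebesgue_measure f.
have := @lebesgue_measure_unique R (m (measurable_addr a)).
apply => // _ [[x y]] _ <-.
rewrite /m /= /pushforward.
rewrite (_ : f @^-1` _ = `](x - a), (y - a)]%classic); last first.
  by apply/seteqP; split => z /=; rewrite !in_itv/= /f ltrBlDr lerBrDr.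
rewrite !lebesgue_measure_itv/= !lte_fin ltrD2r.
by case: ifP => // _; rewrite -!EFinB opprB addrA subrK.
Qed.

Lemma measurable_translate v : measurable_fun setT (translate v).
Proof.
have m1 := measurableT_comp (measurable_addr v.1)
  (@measurable_fst _ _ (measurableTypeR R) (measurableTypeR R)).
have m2 := measurableT_comp (measurable_addr v.2)
  (@measurable_snd _ _ (measurableTypeR R) (measurableTypeR R)).
exact: (measurable_fun_pair m1 m2).
Qed.

(** The same uniqueness argument, with rectangles in place of intervals. *)
Lemma lebesgue2_translation_invariant : translation_invariant (@lebesgue2 R).
Proof.
move=> v A mA; apply/esym.
pose m : {measure set plane -> \bar R} :=
  pushforward (@lebesgue_measure R \x @lebesgue_measure R)%E (translate v).
have := @product_measure_unique _ _ _ _ R lebesgue_measure lebesgue_measure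
  (m (measurable_translate v)).
apply => // B C mB mC.
rewrite /m /= /pushforward.
rewrite (_ : _ @^-1` _ = ((fun x : R => x + v.1) @^-1` B) `*` ((fun x : R => x + v.2) @^-1` C)).
  have mt (a : R) (D : set (measurableTypeR R)) (mD : measurable D) :=
    measurable_preimage (measurable_addr a) mD.
  rewrite product_measure1E; [|exact: (mt v.1 B mB)|exact: (mt v.2 C mC)].
  by congr (_ * _)%E; exact: lebesgue_measure_translate.
by apply/seteqP; split => -[].
Qed.


(* Fubini on [1_Q(y) 1_A(x + y)]: the translation-invariance of [nu] in [x]
   gives the left-hand side, and that of Lebesgue measure in [y] followed by
   that of [nu] in [x] the right-hand side. *)
Lemma translation_invariant_lebesgue2
    (nu : {sigma_finite_measure set plane -> \bar R}) :
    translation_invariant nu ->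
  forall A Q, measurable A -> measurable Q ->
  (lebesgue2 Q * nu A = lebesgue2 A * nu (-%R @^-1` Q))%E.
Proof.
move=> nuT A Q mA mQ.
have m11 := measurableT_comp (@measurable_fst _ _ (measurableTypeR R) (measurableTypeR R))
  (@measurable_fst _ _ plane plane).
have m12 := measurableT_comp (@measurable_snd _ _ (measurableTypeR R) (measurableTypeR R))
  (@measurable_fst _ _ plane plane).
have m21 := measurableT_comp (@measurable_fst _ _ (measurableTypeR R) (measurableTypeR R))
  (@measurable_snd _ _ plane plane).
have m22 := measurableT_comp (@measurable_snd _ _ (measurableTypeR R) (measurableTypeR R))
  (@measurable_snd _ _ plane plane).
have madd : measurable_fun setT (fun z : plane * plane => z.1 + z.2 : plane) :=
  measurable_fun_pair (measurable_funD m11 m21) (measurable_funD m12 m22).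
have msub : measurable_fun setT (fun z : plane * plane => z.1 - z.2 : plane) :=
  measurable_fun_pair (measurable_funB m11 m21) (measurable_funB m12 m22).
have mopp : measurable_fun setT (-%R : plane -> plane) :=
  measurable_fun_pair
    (measurable_funN (@measurable_fst _ _ (measurableTypeR R) (measurableTypeR R)))
    (measurable_funN (@measurable_snd _ _ (measurableTypeR R) (measurableTypeR R))).
(* First coordinates are integrated against Lebesgue measure, second ones against [nu]. For a fixed
   second coordinate [y], the section of [E1] is the translate by [- y] of the section of [E2]. *)
pose E1 : set (plane * plane) := [set z | Q z.1 /\ A (z.1 + z.2)].
pose E2 : set (plane * plane) := [set z | A z.1 /\ Q (z.1 - z.2)].
have mE1 : measurable E1.
  exact: measurableI (measurable_preimage measurable_fst mQ) (measurable_preimage madd mA).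
have mE2 : measurable E2.
  exact: measurableI (measurable_preimage measurable_fst mA) (measurable_preimage msub mQ).
have swap1 := integral_section_swap (@lebesgue2 R) nu mE1.
have swap2 := integral_section_swap (@lebesgue2 R) nu mE2.
have cst (B : set plane) (c : \bar R) : measurable B -> (0 <= c)%E ->
    (\int[@lebesgue2 R]_x ((\1_B x)%:E * c) = lebesgue2 B * c)%E.
  move=> mB c0; rewrite ge0_integralZr ?integral_indic ?setIT//.
  exact: measurableT_comp.
rewrite -cst// -cst; last 2 first.
- exact: mA.
- exact: measure_ge0.
transitivity (\int[@lebesgue2 R]_x nu (xsection E1 x))%E.
  apply: eq_integral => x _; rewrite indicE.
  have [xQ|xQ] := boolP (x \in Q); rewrite ?mul1e ?mul0e.
    rewrite -(nuT x A mA); congr (nu _); apply/seteqP; split => y.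
      by rewrite /xsection/= in_setE /E1 /E2/= /translate/= addrC; split => //; exact: set_mem.
    by rewrite /xsection/= in_setE /E1 /E2/= /translate/= addrC => -[].
  rewrite (_ : xsection _ _ = set0) ?measure0//; apply/seteqP; split => // y.
  by rewrite /xsection/= in_setE /E1 /E2/= => -[/mem_set]; rewrite (negbTE xQ).
rewrite swap1; transitivity (\int[@lebesgue2 R]_x nu (xsection E2 x))%E; last first.
  apply: eq_integral => x _; rewrite indicE.
  have [xA|xA] := boolP (x \in A); rewrite ?mul1e ?mul0e.
    rewrite -(nuT (- x) _ (measurable_preimage mopp mQ)); congr (nu _); apply/seteqP; split => y.
      by rewrite /xsection/= in_setE /E1 /E2/= /translate/= opprD opprK addrC => -[].
    rewrite /xsection/= in_setE /E1 /E2/= /translate/= opprD opprK addrC; split => //; exact: set_mem.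
  rewrite (_ : xsection _ _ = set0) ?measure0//; apply/seteqP; split => // y.
  by rewrite /xsection/= in_setE /E1 /E2/= => -[/mem_set]; rewrite (negbTE xA).
rewrite swap2; apply: eq_integral => x _.
apply: etrans (lebesgue2_translation_invariant x (measurable_ysection x mE2)).
congr lebesgue2; apply/seteqP; split => y;
  by rewrite /ysection/= !in_setE /E1 /E2/= addrK => -[].
Qed.

End translation_invariance.

Section with_sigma_finite.
Context d (T : measurableType d) (R : realType) (m : {measure set T -> \bar R}).
Hypothesis m_sigma_finite : sigma_finite setT m.

(** The [let] makes the hypothesis a parameter of the definition, so that a sigma-finite structure
    can be attached to it. *)
Definition with_sigma_finite : set T -> \bar R := let _ := m_sigma_finite in m.
HB.instance Definition _ := Measure.on with_sigma_finite.
HB.instance Definition _ := Measure_isSigmaFinite.Build _ _ _ with_sigma_finite m_sigma_finite.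

End with_sigma_finite.

Section translation_invariant_measures.
Context {R : realType}.
Local Notation plane := (measurableTypeR R * measurableTypeR R)%type.

Let square (r : R) : set plane := `[0, r[%classic `*` `[0, r[%classic.

Let measurable_square (r : R) : measurable (square r).
Proof. by apply: measurableX; exact: measurable_itv. Qed.

(** The translates of the half-open square by multiples of [r] tile the plane and all have the same
    finite measure. *)
Lemma translation_invariant_sigma_finite (m : {measure set plane -> \bar R}) (r : R) :
  translation_invariant m -> 0 < r -> (m (square r) < +oo)%E -> sigma_finite setT m.
Proof.
move=> mT r0 mr.
pose tile (ij : int * int) : set plane := translate (- (ij.1%:~R * r, ij.2%:~R * r)) @^-1` square r.
(* Pairs of integers are enumerated by [unpickle]; a number that codes no pair gives the empty
   set. *)
pose F n := if unpickle n is Some ij then tile ij else set0.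
exists F.
  apply/seteqP; split => // -[x y] _.
  have cell (z : R) : `[0, r[%classic (z + - ((Num.floor (z / r))%:~R * r)).
    have /andP[lez ltz] := floor_itv (z / r).
    move: lez ltz; rewrite ler_pdivlMr// ltr_pdivrMr// intrD mulrDl mul1r => lez ltz.
    by rewrite /= in_itv/=; apply/andP; split; lra.
  pose ij := (Num.floor (x / r), Num.floor (y / r)).
  exists (pickle ij); first exact: I.
  rewrite /F pickleK; split; exact: cell.
move=> n; rewrite /F; case: unpickle => [ij|]; last by rewrite measure0.
split; first exact: measurable_preimage (measurable_translate _) _.
by rewrite mT.
Qed.

(** The product identity with [Q] the square makes [m] proportional to Lebesgue measure; the factor
    is the measure of the reflected square divided by [r ^+ 2]. *)
Lemma translation_invariant_measureE (m : {measure set plane -> \bar R}) (r : R) :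
  translation_invariant m -> 0 < r -> (m (square r) < +oo)%E ->
  exists2 c : R, 0 <= c & forall A, measurable A -> m A = (c%:E * lebesgue2 A)%E.
Proof.
move=> mT r0 mr.
pose nu := with_sigma_finite (translation_invariant_sigma_finite mT r0 mr).
have nuE A : measurable A -> ((r ^+ 2)%:E * m A = lebesgue2 A * m (-%R @^-1` square r))%E.
  move=> mA; have := @translation_invariant_lebesgue2 R nu mT _ _ mA (measurable_square r).
  by rewrite /lebesgue2 product_measure1E//= lebesgue_measure_itv/= lte_fin r0 sube0 -EFinM -expr2.
have r20 : 0 < r ^+ 2 by rewrite exprn_gt0.
(* The reflected square is half-open on the opposite sides, hence no translate of the square; its
   measure is finite by the identity applied to the square itself. *)
have [Q Qfin] : exists Q, m (-%R @^-1` square r) = Q%:E.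
  have := nuE _ (measurable_square r).
  rewrite /lebesgue2 product_measure1E//= lebesgue_measure_itv/= lte_fin r0 sube0 -EFinM -expr2.
  have [q ->] : exists q, m (square r) = q%:E.
    by exists (fine (m (square r))); rewrite fineK// ge0_fin_numE.
  move=> qE; exists (fine (m (-%R @^-1` square r))); rewrite fineK// ge0_fin_numE// ltey.
  by apply/eqP => moo; move: qE; rewrite moo gt0_muley ?lte_fin// -EFinM.
exists (Q / r ^+ 2).
  by rewrite divr_ge0 ?(ltW r20)// -lee_fin -Qfin measure_ge0.
move=> A mA; have := nuE A mA; rewrite Qfin => /(congr1 (fun z => ((r ^+ 2)^-1)%:E * z)%E).
rewrite muleA -EFinM mulVf ?gt_eqF// mul1e => ->.
by rewrite muleCA -EFinM muleC mulrC.
Qed.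

End translation_invariant_measures.

(** * Hausdorff measure on the plane z = 0 *)

Section plane_hausdorff.
Context {R : realType}.
Local Notation plane := (measurableTypeR R * measurableTypeR R)%type.
Implicit Types (A : set plane) (p q v : plane).

Let measurable_floor : measurable [set p : space3 R | p.2 = 0].
Proof.
rewrite (_ : [set _ | _] = snd @^-1` [set 0 : measurableTypeR R]); last first.
  by apply/seteqP; split.
by apply: (measurable_preimage measurable_snd); exact: measurable_set1.
Qed.

(** Restricting to z = 0 and projecting yields a measure at once; the term is kept transparent so
    that it unfolds by conversion. *)
Definition hausdorff_plane : {measure set plane -> \bar R}.
Proof.
unshelve refine (pushforward (mrestr (@hausdorff2 R) measurable_floor)
  (fst : space3 R -> plane) : {measure set plane -> \bar R}).
exact: measurable_fst.
Defined.

Lemma hausdorff_planeE A : hausdorff_plane A = hausdorff2 ([set p : space3 R | A p.1 /\ p.2 = 0]).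
Proof. by []. Qed.

(** Translations are nonexpansive, which gives one inequality for every [v]; the case of [- v] gives
    the other. *)
Lemma hausdorff_plane_translation_invariant : translation_invariant hausdorff_plane.
Proof.
have le v A : (hausdorff_plane (translate v @^-1` A) <= hausdorff_plane A)%E.
  rewrite !hausdorff_planeE.
  pose f (p : space3 R) : space3 R := (p.1.1 - v.1, p.1.2 - v.2, p.2).
  apply: (hausdorff2_nonexpansive (f := f)).
  - move=> p q _ _; rewrite /edist /f/= le_eqVlt; apply/orP; left; apply/eqP.
    by congr Num.sqrt; ring.
  - move=> -[[x y] z] [/= Axy z0]; exists (x + v.1, y + v.2, z) => //; by rewrite /f /= !addrK.
move=> v A mA; apply/eqP; rewrite eq_le le/=.
rewrite [X in (hausdorff_plane X <= _)%E](_ : A = translate (- v) @^-1` (translate v @^-1` A)).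
  exact: le.
by apply/seteqP; split => p /=; rewrite /translate/= subrK.
Qed.

End plane_hausdorff.

(** * Mean distances *)

Section mean_absolute_difference.
Local Open Scope ereal_scope.
Context {R : realType}.

Lemma measurable_le d (T : measurableType d) (f g : T -> R) :
  measurable_fun setT f -> measurable_fun setT g -> measurable [set x | (f x <= g x)%R].
Proof.
move=> mf mg; have := measurable_fun_ler mf mg measurableT (I : measurable [set true]).
by rewrite setTI.
Qed.

Lemma measurable_lt d (T : measurableType d) (f g : T -> R) :
  measurable_fun setT f -> measurable_fun setT g -> measurable [set x | (f x < g x)%R].
Proof.
move=> mf mg; have := measurable_fun_ltr mf mg measurableT (I : measurable [set true]).
by rewrite setTI.
Qed.

Lemma lebesgue_measure_co (a b : R) : (a <= b)%R -> lebesgue_measure `[a, b[%classic = (b - a)%:E.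
Proof.
by rewrite lebesgue_measure_itv/= lte_fin le_eqVlt => /orP[/eqP->|->//]; rewrite ltxx subrr.
Qed.

Context d (T : measurableType d) (P : probability T R) (f : T -> R).
Hypothesis mf : measurable_fun setT f.

(** [|f p - f q|] is the length of the set of levels [u] that separate [f p] from [f q]; Tonelli
    lets the pair be integrated first, at a fixed level. *)
Lemma integral_cdf_abs_sub :
  \int[P \x P]_z `|f z.1 - f z.2|%:E =
  \int[lebesgue_measure]_u
    (P [set p | f p <= u]%R * P [set p | u < f p]%R +
     P [set p | u < f p]%R * P [set p | f p <= u]%R).
Proof.
pose PP : {sigma_finite_measure set (T * T)%type -> \bar R} :=
  product_subprobability (P : subprobability T R, P : subprobability T R).
have mle u : measurable [set p | f p <= u]%R by apply: measurable_le.
have mlt u : measurable [set p | u < f p]%R by apply: measurable_lt.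
pose E : set ((T * T) * measurableTypeR R)%type :=
  [set z | f z.1.1 <= z.2 /\ z.2 < f z.1.2 \/ z.2 < f z.1.1 /\ f z.1.2 <= z.2]%R.
have mf1 : measurable_fun setT (fun z : ((T * T) * measurableTypeR R)%type => f z.1.1).
  exact: (measurableT_comp (measurableT_comp mf measurable_fst) measurable_fst).
have mf2 : measurable_fun setT (fun z : ((T * T) * measurableTypeR R)%type => f z.1.2).
  exact: (measurableT_comp (measurableT_comp mf measurable_snd) measurable_fst).
have mu2 : measurable_fun setT (fun z : ((T * T) * measurableTypeR R)%type => z.2 : R).
  exact: measurable_snd.
have mE : measurable E.
  by apply: measurableU; apply: measurableI;
    [exact: measurable_le|exact: measurable_lt|exact: measurable_lt|exact: measurable_le].
transitivity (\int[PP]_z lebesgue_measure (xsection E z)).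
  apply: eq_integral => -[p q] _ /=.
  wlog pq : p q / (f p <= f q)%R => [hw|].
    have [/hw//|/ltW qp] := leP (f p) (f q).
    rewrite distrC hw//; congr (lebesgue_measure _); apply/seteqP.
    by split => u; rewrite /xsection/= !in_setE /E/= => -[[]|[]]; [right|left|right|left].
  rewrite (_ : xsection _ _ = `[f p, f q[%classic).
    by rewrite lebesgue_measure_co// distrC ger0_norm// subr_ge0.
  apply/seteqP; split => u; rewrite /xsection/= in_setE in_itv /E/=.
    by case=> [[-> ->//]|[up qu]]; have := lt_le_trans up pq; rewrite ltNge qu.
  by move=> /andP[]; left.
rewrite integral_section_swap//; apply: eq_integral => u _.
rewrite (_ : ysection E u =
    [set p | f p <= u]%R `*` [set p | u < f p]%R `|`
    [set p | u < f p]%R `*` [set p | f p <= u]%R); last first.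
  by apply/seteqP; split => -[p q]; rewrite /ysection/= in_setE.
rewrite measureU; first by congr (_ + _); exact: product_measure1E.
- exact: measurableX.
- exact: measurableX.
- by apply/seteqP; split => // -[p q] [[/= pu _] [/= up _]]; move: up; rewrite ltNge pu.
Qed.

End mean_absolute_difference.

(** * Areas and volumes *)

Section area_volume.
Context {R : realType}.
Local Notation plane := (measurableTypeR R * measurableTypeR R)%type.
Implicit Types (a b : R) (g h : R -> R).

Lemma measurable_polyE (f : R -> R) (c : nat -> R) (n : nat) :
  (forall x, f x = \sum_(i < n) c i * x ^+ i) -> measurable_fun setT f.
Proof.
move=> fE; rewrite (_ : f = fun x => \sum_(i < n) c i * x ^+ i); last exact/funext.
by apply: measurable_sum => i; apply: measurable_funM => //; exact: exprn_measurable.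
Qed.

(** The fundamental theorem of calculus for a coefficientwise antiderivative. Explicit coefficients
    turn the integrals below into finite sums, open to [field] and [lra]. *)
Lemma integral_itv_poly (f : R -> R) (c : nat -> R) (n : nat) (a b : R) : a <= b ->
    (forall x, f x = \sum_(i < n) c i * x ^+ i) ->
  (\int[lebesgue_measure]_(x in `[a, b]) (f x)%:E =
   (\sum_(i < n) c i * (b ^+ i.+1 - a ^+ i.+1) / i.+1%:R)%:E)%E.
Proof.
(* The fundamental theorem asks for [a < b], so the one-point interval is treated apart. *)
move=> + fE; rewrite le_eqVlt => /orP[/eqP <-|ab].
  rewrite set_itv1 integral_set1; congr EFin.
  by rewrite big1// => i _; rewrite subrr mulr0 mul0r.
pose p := \poly_(i < n) c i.
pose P : {poly R} := \poly_(i < n.+1) (if i is j.+1 then c j / i%:R else 0).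
have dP : P^`() = p.
  apply/polyP => i; rewrite coef_deriv !coef_poly ltnS; case: ifP => _; last by rewrite mul0rn.
  by rewrite -[LHS]mulr_natr divfK// pnatr_eq0.
have PE x : P.[x] = \sum_(i < n) c i * x ^+ i.+1 / i.+1%:R.
  rewrite horner_poly big_ord_recl/= mul0r add0r.
  by apply: eq_bigr => i _; rewrite mulrAC.
under eq_integral do rewrite fE -horner_poly.
rewrite (@continuous_FTC2 _ _ (horner P))//.
- rewrite -EFinB !PE -sumrB; congr EFin; apply: eq_bigr => i _.
  by rewrite mulrBr mulrBl.
- by apply: continuous_subspaceT; exact: continuous_horner.
- split.
  + by move=> x _; exact: derivable_horner.
  + by apply: cvg_at_right_filter; exact: continuous_horner.
  + by apply: cvg_at_left_filter; exact: continuous_horner.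
- by move=> x _; rewrite -derivE dP.
Qed.

Lemma lebesgue_measure_sym_itv (r : R) : 0 <= r ->
  lebesgue_measure [set x : measurableTypeR R | `|x| <= r] = (2 * r)%:E.
Proof.
move=> r0; rewrite (_ : [set _ | _] = `[- r, r]%classic); last first.
  by apply/seteqP; split => x; rewrite /= in_itv/= ler_norml.
rewrite lebesgue_measure_itv/= lte_fin.
have [_|] := ltP; first by rewrite -EFinB; congr EFin; ring.
by move=> rr; congr EFin; lra.
Qed.

Definition sym_strip (a b : R) (g : R -> R) : set plane :=
  [set p | a <= p.1 <= b /\ `|p.2| <= g p.1].

Lemma measurable_sym_strip a b g : measurable_fun setT g -> measurable (sym_strip a b g).
Proof.
move=> mg; rewrite (_ : sym_strip a b g =
    (fst @^-1` (`[a, b]%classic : set (measurableTypeR R))) `&`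
    [set p : plane | `|p.2| <= g p.1]).
  apply: measurableI.
    by apply: (measurable_preimage measurable_fst); exact: measurable_itv.
  apply: measurable_le.
    exact: (measurableT_comp (@normr_measurable R setT) measurable_snd).
  exact: (measurableT_comp mg measurable_fst).
by apply/seteqP; split => p; rewrite /sym_strip/= in_itv.
Qed.

(** The product measure integrates the lengths of the sections, which are [[- g x, g x]] over
    [[a, b]] and empty elsewhere. *)
Lemma lebesgue2_sym_strip a b g : measurable_fun setT g ->
    (forall x, a <= x <= b -> 0 <= g x) ->
  lebesgue2 (sym_strip a b g) = (\int[lebesgue_measure]_(x in `[a, b]) (2 * g x)%:E)%E.
Proof.
move=> mg g0; rewrite /lebesgue2 /product_measure1 [RHS]integral_mkcond.
apply: eq_integral => x _ /=; rewrite patchE.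
have [|] := boolP (x \in _).
  rewrite inE/= in_itv/= => xab.
  rewrite -lebesgue_measure_sym_itv ?g0//; congr lebesgue_measure.
  apply/seteqP; split => y; rewrite /xsection/= in_setE /sym_strip/=; first by case.
  by [].
rewrite notin_setE/= in_itv/= => /negP xab.
rewrite (_ : xsection _ _ = set0) ?measure0//; apply/seteqP; split => // y.
by rewrite /xsection/= in_setE /sym_strip/= => -[]; rewrite (negbTE xab).
Qed.

Definition sym_wedge (a b : R) (g h : R -> R) : set (space3 R) :=
  [set p | sym_strip a b g p.1 /\ `|p.2| <= h p.1.1].

(** Integrating out the third coordinate gives [2 * h], and then the second one contributes
    [2 * g]. *)
Lemma lebesgue3_sym_wedge a b g h : measurable_fun setT g -> measurable_fun setT h ->
    (forall x, a <= x <= b -> 0 <= g x) -> (forall x, a <= x <= b -> 0 <= h x) ->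
  lebesgue3 (sym_wedge a b g h) =
  (\int[lebesgue_measure]_(x in `[a, b]) (4 * (g x * h x))%:E)%E.
Proof.
move=> mg mh g0 h0; rewrite /lebesgue3 {1}/product_measure1.
transitivity (\int[@lebesgue2 R]_(p in sym_strip a b g) (2 * h p.1)%:E)%E.
  rewrite [RHS]integral_mkcond.
  apply: eq_integral => p _ /=; rewrite patchE.
  have [|] := boolP (p \in _).
    rewrite inE => pab.
    rewrite -lebesgue_measure_sym_itv ?h0//; last by case: pab.
    congr lebesgue_measure; apply/seteqP.
    split => y; rewrite /xsection/= in_setE /sym_wedge/=; first by case.
    by [].
  rewrite notin_setE => pab.
  rewrite (_ : xsection _ _ = set0) ?measure0//; apply/seteqP; split => // y.
  by rewrite /xsection/= in_setE /sym_wedge/= => -[].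
have mS := measurable_sym_strip a b mg.
have mhS : measurable_fun setT ((fun p : plane => (2 * h p.1)%:E) \_ (sym_strip a b g)).
  apply/(measurable_restrictT _ mS)/measurable_EFinP/measurable_funTS.
  apply: measurable_funM => //.
  exact: (measurableT_comp mh measurable_fst).
rewrite integral_mkcond /lebesgue2 fubini_tonelli1//; last first.
  move=> p; rewrite patchE; case: ifPn => // /set_mem[pab _].
  by rewrite lee_fin mulr_ge0// h0.
rewrite [RHS]integral_mkcond; apply: eq_integral => x _ /=.
rewrite /fubini_F patchE; have [|] := boolP (x \in _).
  rewrite inE/= in_itv/= => xab.
  transitivity (\int[lebesgue_measure]_(y in
      [set y : measurableTypeR R | `|y| <= g x]%R) (2 * h x)%:E)%E.
    rewrite [RHS]integral_mkcond; apply: eq_integral => y _.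
    rewrite !patchE; congr (if _ then _ else _).
    by apply/idP/idP => /set_mem H; apply/mem_set => //; case: H.
  rewrite integral_cst; last first.
    exact: (@measurable_le R _ (measurableTypeR R) _ _
      (@normr_measurable R setT) (measurable_cst (g x))).
  rewrite [X in (_ * X)%E](lebesgue_measure_sym_itv (g0 x xab)).
  by rewrite -EFinM; congr EFin; ring.
rewrite notin_setE/= in_itv/= => /negP xab.
apply: integral0_eq => y _; rewrite patchE; case: ifPn => // /set_mem[].
by rewrite /= (negbTE xab).
Qed.

End area_volume.

(** * Uniform laws and bounds for mean distances *)

Section uniform_on.
Context {R : realType}.

Lemma uniform_onE (mu : {measure set (space3 R) -> \bar R}) (D : set (space3 R))
    (mD : measurable D) (m : R) :
    0 < m -> mu D = m%:E ->
  forall U, (uniform_on mu mD U = mu (U `&` D) * (m^-1)%:E)%E.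
Proof.
move=> m0 muD U; rewrite /uniform_on/= /mnormalize/= /mrestr/= setTI muD/=.
by rewrite eqe gt_eqF.
Qed.

Lemma uniform_on_degenerate (mu : {measure set (space3 R) -> \bar R}) (D : set (space3 R))
    (mD : measurable D) :
    (mu D == 0%E) || (mu D == +oo%E) ->
  forall U, uniform_on mu mD U = dirac point U.
Proof.
by move=> muD U; rewrite /uniform_on/= /mnormalize/= /mrestr/= setTI muD.
Qed.

End uniform_on.

Section mean_distance_bounds.
Local Open Scope ereal_scope.
Context {R : realType}.

(** Both functions measure the sections of a measurable subset of the product with the line. *)
Lemma measurable_cdf d (T : measurableType d) (P : probability T R) (f : T -> R) :
  measurable_fun setT f ->
  measurable_fun setT (fun u : measurableTypeR R => P [set p | f p <= u]%R) /\
  measurable_fun setT (fun u : measurableTypeR R => P [set p | u < f p]%R).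
Proof.
move=> mf.
have mf1 : measurable_fun setT (fun z : (T * measurableTypeR R)%type => f z.1).
  exact: (measurableT_comp mf measurable_fst).
have mf2 : measurable_fun setT (fun z : (T * measurableTypeR R)%type => z.2 : R).
  exact: measurable_snd.
split.
  have /(measurable_fun_ysection P) := measurable_le mf1 mf2.
  apply: eq_measurable_fun => u _ /=; congr (P _).
  by apply/seteqP; split => p; rewrite /ysection/= in_setE.
have /(measurable_fun_ysection P) := measurable_lt mf2 mf1.
apply: eq_measurable_fun => u _ /=; congr (P _).
by apply/seteqP; split => p; rewrite /ysection/= in_setE.
Qed.

(** At a level outside [[a, b]] one of the two probabilities vanishes. *)
Lemma integral_cdf_abs_sub_itv d (T : measurableType d) (P : probability T R)
    (f : T -> R) (a b : R) :
    measurable_fun setT f -> P [set p | (a <= f p)%R /\ (f p <= b)%R] = 1 ->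
  \int[P \x P]_z `|f z.1 - f z.2|%:E =
  \int[lebesgue_measure]_(u in `[a, b])
    (P [set p | f p <= u]%R * P [set p | u < f p]%R +
     P [set p | u < f p]%R * P [set p | f p <= u]%R).
Proof.
move=> mf Pab; rewrite integral_cdf_abs_sub// [RHS]integral_mkcond.
have mab : measurable [set p | (a <= f p)%R /\ (f p <= b)%R].
  apply: measurableI; first exact: (measurable_le (measurable_cst a) mf).
  exact: (measurable_le mf (measurable_cst b)).
have P0 (A : set T) : measurable A -> A `&` [set p | (a <= f p)%R /\ (f p <= b)%R] = set0 ->
    P A = 0.
  move=> mA A0; apply/eqP; rewrite eq_le measure_ge0 andbT.
  rewrite -[leRHS](_ : P (~` [set p | (a <= f p)%R /\ (f p <= b)%R]) = 0); last first.
    by rewrite probability_setC// Pab subee.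
  apply: le_measure; rewrite ?inE//; first exact: measurableC.
  by move=> p Ap abp; rewrite -[False]/(set0 p) -A0.
apply: eq_integral => u _; rewrite patchE.
case: ifPn => //; rewrite notin_setE/= in_itv/= => /negP; rewrite negb_and -!ltNge => /orP[ua|bu].
  rewrite (P0 [set p | (f p <= u)%R]) ?mul0e ?mule0 ?adde0//;
    first exact: (measurable_le mf (measurable_cst u)).
  apply/seteqP; split => // p [/= pu [ap _]].
  by have := lt_le_trans ua (le_trans ap pu); rewrite ltxx.
rewrite (P0 [set p | (u < f p)%R]) ?mul0e ?mule0 ?adde0//;
    first exact: (measurable_lt (measurable_cst u) mf).
apply/seteqP; split => // p [/= pu [_ pb]].
by have := lt_le_trans bu (le_trans (ltW pu) pb); rewrite ltxx.
Qed.

Lemma measurable_edist : measurable_fun setT (fun z : space3 R * space3 R => edist z.1 z.2).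
Proof.
have mx : measurable_fun setT (fun p : space3 R => p.1.1 : R).
  exact: (measurableT_comp measurable_fst measurable_fst).
have my : measurable_fun setT (fun p : space3 R => p.1.2 : R).
  exact: (measurableT_comp measurable_snd measurable_fst).
have mz : measurable_fun setT (fun p : space3 R => p.2 : R).
  exact: measurable_snd.
have sqr_sub (f : space3 R -> R) : measurable_fun setT f ->
    measurable_fun setT (fun z : space3 R * space3 R => (f z.1 - f z.2) ^+ 2)%R.
  move=> mf; apply: measurable_funX; apply: measurable_funB.
    exact: (measurableT_comp mf measurable_fst).
  exact: (measurableT_comp mf measurable_snd).
rewrite /edist; apply: (measurableT_comp (continuous_measurable_fun (@sqrt_continuous R))).
exact: (measurable_funD (measurable_funD (sqr_sub _ mx) (sqr_sub _ my)) (sqr_sub _ mz)).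
Qed.

(** The pointwise bound holds on the square of [D], which has full measure for the joint law. *)
Lemma mean_distance_le (P : probability (space3 R) R) (D : set (space3 R))
    (g : space3 R * space3 R -> R) :
    measurable D -> P D = 1 -> measurable_fun setT g -> (forall z, 0 <= g z)%R ->
    (forall p q, D p -> D q -> (edist p q <= g (p, q))%R) ->
  mean_distance P <= \int[P \x P]_z (g z)%:E.
Proof.
move=> mD PD mg g0 Dg; rewrite /mean_distance unlock.
apply: ae_ge0_le_integral => //.
- by move=> z _; rewrite lee_fin edist_ge0.
- by apply/measurable_EFinP; exact: measurable_edist.
- by move=> z _; rewrite lee_fin.
- by apply/measurable_EFinP; exact: mg.
exists (~` (D `*` D)); split.
- by apply: measurableC; exact: measurableX.
- have mDD : measurable (D `*` D) by exact: measurableX.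
  apply: etrans (product_subprobability_setC
    (P : subprobability _ R, P : subprobability _ R) mDD) _.
  rewrite /= -setXTT !product_measure1E//.
  transitivity (P setT * P setT - P D * P D); first by [].
  by rewrite PD probability_setT mule1 subee.
- move=> [p q] /= npq [Dp Dq]; apply: npq => _.
  by rewrite lee_fin Dg.
Qed.

Lemma le_mean_distance (P : probability (space3 R) R) :
  \int[P \x P]_z `|z.1.1.1 - z.2.1.1|%:E <= mean_distance P.
Proof.
rewrite /mean_distance unlock; apply: ge0_le_integral => //.
- apply/measurable_EFinP; apply: (measurableT_comp (@normr_measurable R setT)).
  have mx : measurable_fun setT (fun p : space3 R => p.1.1 : R).
    exact: (measurableT_comp measurable_fst measurable_fst).
  exact: (measurable_funB (measurableT_comp mx measurable_fst)
    (measurableT_comp mx measurable_snd)).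
- by apply/measurable_EFinP; exact: measurable_edist.
- move=> z _; rewrite lee_fin /edist -sqrtr_sqr ler_sqrt.
    by rewrite -addrA lerDl addr_ge0 ?sqr_ge0.
  by rewrite !addr_ge0 ?sqr_ge0.
Qed.

End mean_distance_bounds.

(** * The boundary of the body and its surface measure *)

Section wedge.
Context {R : realType}.

(** With s = 1000 t, this function and the next are the bounds t and (1 - 2 t / 3) / 100 of the
    body, rewritten in s. *)
Definition half_width (s : R) : R := s / 1000.
(* [150000] is written as a product because numerals are expanded in unary. *)
Definition half_thickness (s : R) : R := 1 / 100 - s / (150 * 1000).
Local Notation wid := half_width.
Local Notation thk := half_thickness.

Lemma Kset_wedge : Kset 1000 (1 / 100) = sym_wedge 0 1000 wid thk.
Proof.
rewrite /sym_wedge /sym_strip /wid /thk.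
apply/seteqP; split => [_ [t [x [y [-> [t01 xt yt]]]]]|[[s x] y]] /=.
  split; last by lra.
  by split; lra.
move=> [[s01 xs] ys]; exists (s / 1000), x, y; split; first by congr (_, _, _); lra.
by split; lra.
Qed.

Lemma measurable_half_width : measurable_fun setT (wid : R -> R).
Proof. by apply: measurable_funM. Qed.

Lemma measurable_half_thickness : measurable_fun setT (thk : R -> R).
Proof. by apply: measurable_funB => //; apply: measurable_funM. Qed.

(** The points where a constraint is tight. The edge s = 0 falls under the second case, since the
    width vanishes there. *)
Definition wedge_faces : set (space3 R) := [set p |
  sym_wedge 0 1000 wid thk p /\ [\/ p.1.1 = 1000, `|p.1.2| = wid p.1.1 | `|p.2| = thk p.1.1]].

Lemma exists_pos_le3 (x y z : R) : 0 < x -> 0 < y -> 0 < z ->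
  exists2 d, 0 < d & [/\ d <= x, d <= y & d <= z].
Proof.
move=> x0 y0 z0; exists (Num.min x (Num.min y z)); first by rewrite !lt_min x0 y0.
by split; rewrite !ge_min lexx ?orbT.
Qed.

Lemma normr_le_add (x y d : R) : `|x - y| < d -> `|y| <= `|x| + d.
Proof.
by move=> xyd; rewrite -[y in leLHS](subKr x) (le_trans (ler_normB _ _))// lerD2l ltW.
Qed.

(** A point of the body at which all three constraints are strict has a small ball around it inside
    the body. *)
Lemma boundary_subset_faces : boundary (Kset 1000 (1 / 100)) `<=` wedge_faces.
Proof.
have L0 : (0 : R) < 1000 by lra.
have e0 : (0 : R) < 1 / 100 by lra.
have cK := compact_closed (@norm_hausdorff _ _) (Kset_compact L0 e0).
move=> p [/cK Kp nKp]; have := Kp; rewrite Kset_wedge => wp; split => //.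
apply: contrapT => np; apply: nKp.
have [sL [xw yt]] : p.1.1 < 1000 /\ `|p.1.2| < wid p.1.1 /\ `|p.2| < thk p.1.1.
  case: wp => -[/andP[_ s1] xw] yt.
  split; first by rewrite lt_neqAle s1 andbT; apply/eqP => E; apply: np; constructor 1.
  split; first by rewrite lt_neqAle xw andbT; apply/eqP => E; apply: np; constructor 2.
  by rewrite lt_neqAle yt andbT; apply/eqP => E; apply: np; constructor 3.
rewrite Kset_wedge; move: p sL xw yt {Kp wp np} => [[s x] y]/= sL xw yt.
(* A quarter of each slack is enough: a move by [d] changes [|x|] and [|y|] by at most [d], and the
   bounds on them by far less. *)
have [d d0 [d1 d2 d3]] : exists2 d : R, 0 < d &
    [/\ d <= (1000 - s) / 4, d <= (wid s - `|x|) / 4 & d <= (thk s - `|y|) / 4].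
  by apply: exists_pos_le3; lra.
apply/nbhs_ballP; exists d; first exact: d0.
move=> -[[s' x'] y'] [[]]; rewrite -!ball_normE/=.
rewrite /wid /thk in xw yt d2 d3 * => hs hx hy.
rewrite /sym_wedge /sym_strip/=.
have nx := normr_le_add hx; have ny := normr_le_add hy; have := normr_ge0 x.
move: hs; rewrite ltr_norml => /andP[hs1 hs2] x0.
have {}hx : `|x'| <= s' / 1000 by lra.
have {}hy : `|y'| <= 1 / 100 - s' / (150 * 1000) by lra.
clear ny d3 yt; split => //; split => //.
(* The constraint on [x'] already forces [s'] to be nonnegative. *)
have s0 : 0 <= s' by have := le_trans (normr_ge0 x') hx; lra.
by rewrite s0/=; lra.
Qed.

(** A step of length [d / 2] in the third coordinate, away from 0, leaves the body however small [d]
    is. *)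
Lemma thick_faces_subset_boundary (p : space3 R) :
  sym_strip 0 1000 wid p.1 -> `|p.2| = thk p.1.1 -> boundary (Kset 1000 (1 / 100)) p.
Proof.
move=> sp yp; split.
  by apply: subset_closure; rewrite Kset_wedge; split; rewrite ?yp.
rewrite Kset_wedge => /nbhs_ballP[d /= d0].
have [pneg|ppos] := ltP p.2 0.
  move=> /(_ (p.1, p.2 - d / 2)) []/=.
    by split; [exact: ballxx|rewrite -ball_normE/= opprB addrC subrK gtr0_norm; lra].
  by move=> _; rewrite -yp !ltr0_norm//; lra.
move=> /(_ (p.1, p.2 + d / 2)) []/=.
  by split; [exact: ballxx|rewrite -ball_normE/= opprD addrA subrr sub0r normrN gtr0_norm; lra].
by move=> _; rewrite -yp !ger0_norm//; lra.
Qed.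

End wedge.

Section surface.
Context {R : realType}.
Local Notation plane := (measurableTypeR R * measurableTypeR R)%type.
Local Notation wid := (@half_width R).
Local Notation thk := (@half_thickness R).
Local Notation cap := (sym_strip (- 1) 1 (cst (1 / 100)) : set plane).
Local Notation surf := (boundary (Kset 1000 (1 / 100) : set (space3 R))).

Lemma edist_le_sum (p q : space3 R) :
  edist p q <= `|p.1.1 - q.1.1| + `|p.1.2 - q.1.2| + `|p.2 - q.2|.
Proof.
rewrite -[leRHS]ger0_norm ?addr_ge0// -sqrtr_sqr; apply: ler_wsqrtr.
move: (p.1.1 - q.1.1) (p.1.2 - q.1.2) (p.2 - q.2) => x y z.
rewrite -(real_normK (num_real x)) -(real_normK (num_real y)) -(real_normK (num_real z)).
move: (normr_ge0 x) (normr_ge0 y) (normr_ge0 z); move: `|x| `|y| `|z| => a b c a0 b0 c0.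
have ab := mulr_ge0 a0 b0; have bc := mulr_ge0 b0 c0; have ac := mulr_ge0 a0 c0.
by nra.
Qed.

Lemma edist_le (k : R) (p q p' q' : space3 R) : 0 <= k ->
    (p.1.1 - q.1.1) ^+ 2 + (p.1.2 - q.1.2) ^+ 2 + (p.2 - q.2) ^+ 2 <=
    k ^+ 2 * ((p'.1.1 - q'.1.1) ^+ 2 + (p'.1.2 - q'.1.2) ^+ 2 + (p'.2 - q'.2) ^+ 2) ->
  edist p q <= k * edist p' q'.
Proof.
move=> k0 pq; rewrite /edist -{1}(ger0_norm k0) -sqrtr_sqr -sqrtrM ?sqr_ge0//.
exact: ler_wsqrtr.
Qed.

(** Each face is a graph over a flat region with a slope [c] of absolute value at most 1/1000. The
    squared Lipschitz constant is thus at most 1 + c^2, and the crude estimate c^2 <= 1/1000 keeps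
    it below [k ^+ 2]. *)
Let k : R := 1001 / 1000.

Let k_ge0 : 0 <= k. Proof. by rewrite /k; lra. Qed.
Let k_gt0 : 0 < k. Proof. by rewrite /k; lra. Qed.
Let k_sqr : 1 + 1000^-1 <= k ^+ 2. Proof. by rewrite /k expr2; lra. Qed.

Let slope_sqr (c d : R) : `|c| <= 1000^-1 -> (c * d) ^+ 2 <= 1000^-1 * d ^+ 2.
Proof.
move=> c1; rewrite exprMn ler_wpM2r ?sqr_ge0// -real_normK ?num_real// expr2.
have c2 : `|c| <= 1 by apply: le_trans c1 _; lra.
apply: (le_trans _ c1); exact: ler_piMl.
Qed.

Let slope_bound (x y z u : R) : 0 <= x -> 0 <= y -> 0 <= z -> u <= 1000^-1 * x ->
  x + y + u <= k ^+ 2 * (x + y + z).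
Proof.
move=> x0 y0 z0 ux; apply: (@le_trans _ _ ((1 + 1000^-1) * (x + y + z))); first by lra.
by rewrite ler_wpM2r ?k_sqr// !addr_ge0.
Qed.

(** The slab of the surface is covered by Lipschitz images of flat regions: two large faces, two
    narrow side faces and the end face. *)
Lemma hausdorff2_surface_le (a b : R) :
  (hausdorff2 (surf `&` [set p | (a <= p.1.1 <= b)%R]) <=
   (k ^+ 2)%:E * ((hausdorff_plane (sym_strip a b wid) + hausdorff_plane (sym_strip a b wid)) +
    (hausdorff_plane (sym_strip a b thk) + hausdorff_plane (sym_strip a b thk)) +
    hausdorff_plane cap))%E.
Proof.
pose floor (A : set plane) : set (space3 R) := [set p | A p.1 /\ p.2 = 0].
pose W := sym_strip a b wid; pose T := sym_strip a b thk; pose C : set plane := cap.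
(* [fW] lifts to the large faces and [fT] to the side faces, [e] being the sign that selects one of
   the pair; [fC] lifts to the end face s = 1000. *)
pose fW (e : R) (p : space3 R) : space3 R := (p.1.1, p.1.2, e * thk p.1.1).
pose fT (e : R) (p : space3 R) : space3 R := (p.1.1, e * wid p.1.1, p.1.2).
pose fC (p : space3 R) : space3 R := (1000, p.1.1, p.1.2).
have lipW e p q : e ^+ 2 = 1 -> edist (fW e p) (fW e q) <= k * edist p q.
  move=> e1; apply: edist_le => //=; apply: slope_bound; [exact: sqr_ge0..|].
  rewrite (_ : _ - _ = e * (- 1 / (150 * 1000) * (p.1.1 - q.1.1))); last first.
    by rewrite /half_thickness; field.
  by rewrite exprMn e1 [leLHS]mul1r slope_sqr// ler_norml; apply/andP; split; lra.
have lipT e p q : e ^+ 2 = 1 -> edist (fT e p) (fT e q) <= k * edist p q.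
  move=> e1; apply: edist_le => //=; rewrite [leLHS]addrAC.
  apply: slope_bound; [exact: sqr_ge0..|].
  rewrite (_ : _ - _ = e * (1 / 1000 * (p.1.1 - q.1.1))); last by rewrite /half_width; field.
  by rewrite exprMn e1 [leLHS]mul1r slope_sqr// ler_norml; apply/andP; split; lra.
have lipC p q : edist (fC p) (fC q) <= k * edist p q.
  apply: edist_le => //=; rewrite subrr expr0n/= add0r.
  rewrite -[leLHS]addr0; apply: slope_bound; [exact: sqr_ge0..|].
  by apply: mulr_ge0; [rewrite invr_ge0 ler0n|exact: sqr_ge0].
have le_img (f : space3 R -> space3 R) (A : set plane) :
    (forall p q, edist (f p) (f q) <= k * edist p q) ->
    (hausdorff2 (f @` floor A) <= (k ^+ 2)%:E * hausdorff_plane A)%E.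
  move=> fk; rewrite hausdorff_planeE.
  by apply: (hausdorff2_lipschitz (f := f)) => // p q _ _; exact: fk.
have cover : surf `&` [set p | a <= p.1.1 <= b] `<=`
    (fW 1 @` floor W `|` fW (-1) @` floor W) `|`
    (fT 1 @` floor T `|` fT (-1) @` floor T) `|` fC @` floor C.
  move=> [[s x] y] [/boundary_subset_faces[[/= [s01 xw] yt]]] + sab /=.
  have [s0 s1] := andP s01.
  case=> /= [sE|xE|yE].
  - right; exists ((x, y), 0); last by rewrite /fC/= -sE.
    split => //; rewrite /C /sym_strip/= -ler_norml; split.
      by apply: (le_trans xw); rewrite /half_width; lra.
    by apply: (le_trans yt); rewrite /half_thickness; lra.
  - left; right; have [x0|/ltW x0] := leP 0 x.
      by left; exists ((s, y), 0) => //; rewrite /fT/= -xE ger0_norm// mul1r.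
    by right; exists ((s, y), 0) => //; rewrite /fT/= -xE ler0_norm// mulN1r opprK.
  left; left; have [y0|/ltW y0] := leP 0 y.
    by left; exists ((s, x), 0) => //; rewrite /fW/= -yE ger0_norm// mul1r.
  by right; exists ((s, x), 0) => //; rewrite /fW/= -yE ler0_norm// mulN1r opprK.
apply: le_trans (le_hausdorff2 cover) _.
have U2 := @outer_measureU2 _ _ (@hausdorff2 R).
have s1 : (-1 : R) ^+ 2 = 1 by rewrite sqrrN expr1n.
have s0 : (1 : R) ^+ 2 = 1 by rewrite expr1n.
apply: le_trans (U2 _ _) _.
have k2 : (0 <= (k ^+ 2)%:E)%E by rewrite lee_fin sqr_ge0.
rewrite !ge0_muleDr ?adde_ge0//.
apply: leeD; last exact: le_img.
apply: le_trans (U2 _ _) _; apply: leeD.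
  by apply: le_trans (U2 _ _) _; apply: leeD; apply: le_img => p q; apply: lipW.
by apply: le_trans (U2 _ _) _; apply: leeD; apply: le_img => p q; apply: lipT.
Qed.

(** Projection to z = 0 is nonexpansive and maps each of the two large faces onto the whole
    triangle. *)
Lemma hausdorff2_surface_ge :
  (hausdorff_plane (sym_strip 0%R 1000%R wid) +
   hausdorff_plane (sym_strip 0%R 1000%R wid) <= hausdorff2 surf)%E.
Proof.
pose W := sym_strip 0%R 1000%R wid.
pose proj (p : space3 R) : space3 R := (p.1, 0).
pose up : set (space3 R) := [set p | 0 < p.2]. 
have proj_le p q : edist (proj p) (proj q) <= edist p q.
  rewrite -[leRHS]mul1r; apply: edist_le => //=.
  by rewrite expr1n mul1r lerD2l subrr expr0n/= sqr_ge0.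
have thk_gt0 p : W p -> 0 < thk p.1.
  by move=> [/andP[_ p1] _]; rewrite /half_thickness; lra.
have le_part (D : set (space3 R)) (e : R) : `|e| = 1 -> (forall p, W p -> D (p, e * thk p.1)) ->
    (hausdorff_plane W <= hausdorff2 (surf `&` D))%E.
  move=> e1 WD; rewrite hausdorff_planeE.
  apply: (hausdorff2_nonexpansive (f := proj)); first by move=> p q _ _; exact: proj_le.
  move=> [p z] [/= Wp z0]; exists (p, e * thk p.1); last by rewrite /proj/= z0.
  split; last exact: WD.
  apply: (@thick_faces_subset_boundary R (p, e * thk p.1) Wp).
  by rewrite /= normrM e1 mul1r gtr0_norm// thk_gt0.
have mup : measurable up.
  exact: measurable_lt (measurable_cst _) measurable_snd.
have msurf : measurable surf by apply: closed_measurable3; exact: closed_boundary.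
(* The sign of the third coordinate separates the two large faces by a measurable set, so their
   measures add up. *)
rewrite -(setIT surf) -(setUv up) setIUr measureU; last 3 first.
- exact: measurableI.
- by apply: measurableI => //; exact: measurableC.
- by rewrite setIACA setICr setI0.
apply: leeD.
  apply: (le_part _ 1); first exact: normr1.
  by move=> p Wp; rewrite /up/= mul1r thk_gt0.
apply: (le_part _ (-1)); first by rewrite normrN1.
by move=> p Wp; rewrite /up/= mulN1r oppr_gt0; have := thk_gt0 _ Wp; lra.
Qed.

End surface.

(** * The surface side *)

Section theta_bound.
Context {R : realType}.
Local Notation plane := (measurableTypeR R * measurableTypeR R)%type.
Local Notation wid := (@half_width R).
Local Notation thk := (@half_thickness R).
Local Notation cap := (sym_strip (- 1) 1 (cst (1 / 100)) : set plane).
Local Notation surf := (boundary (Kset 1000 (1 / 100) : set (space3 R))).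

Lemma lebesgue2_width_strip (a b : R) : 0 <= a -> a <= b ->
  lebesgue2 (sym_strip a b wid) = ((b ^+ 2 - a ^+ 2) / 1000)%:E.
Proof.
move=> a0 ab; rewrite lebesgue2_sym_strip; first last.
- by move=> x /andP[ax _]; rewrite /half_width; lra.
- exact: measurable_half_width.
rewrite (@integral_itv_poly _ _ (nth 0 [:: 0; 2 / 1000]) 2); first last.
- by move=> x; rewrite !big_ord_recr big_ord0 /= /half_width; field.
- by [].
rewrite !big_ord_recr big_ord0 /=; congr EFin.
by field.
Qed.

Lemma lebesgue2_thickness_strip (a b : R) : a <= b -> b <= 1000 ->
  lebesgue2 (sym_strip a b thk) = ((b - a) / 50 - (b ^+ 2 - a ^+ 2) / (150 * 1000))%:E.
Proof.
move=> ab b1; rewrite lebesgue2_sym_strip; first last.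
- by move=> x /andP[_ xb]; rewrite /half_thickness; lra.
- exact: measurable_half_thickness.
rewrite (@integral_itv_poly _ _ (nth 0 [:: 1 / 50; - (2 / (150 * 1000))]) 2); first last.
- by move=> x; rewrite !big_ord_recr big_ord0 /= /half_thickness; field.
- by [].
rewrite !big_ord_recr big_ord0 /=; congr EFin.
by field.
Qed.

Lemma lebesgue2_cap : lebesgue2 cap = (4 / 100)%:E.
Proof.
rewrite lebesgue2_sym_strip; first last.
- by move=> x _ /=; lra.
- exact: measurable_cst.
rewrite (@integral_itv_poly _ _ (nth 0 [:: 2 / 100]) 1); first last.
- by move=> x; rewrite !big_ord_recr big_ord0 /=; field.
- by lra.
by rewrite !big_ord_recr big_ord0 /=; congr EFin; field.
Qed.

(* Each pair of opposite faces is counted with the Lipschitz factor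
   [1001 / 1000]; the last summand is the face [s = 1000], crudely contained in
   [-1, 1] x [-1/100, 1/100] and counted for every slab. *)
Definition surface_bound (a b : R) : R := (1001 / 1000) ^+ 2 *
  (2 * ((b ^+ 2 - a ^+ 2) / 1000) +
   2 * ((b - a) / 50 - (b ^+ 2 - a ^+ 2) / (150 * 1000)) + 4 / 100).

(* With [x], [y], [z], [w] below, [surface_bound 0 u] is
   [k * (x * u ^+ 2 + y * u + z)] and [surface_bound u 1000] is
   [k * (w - y * u - x * u ^+ 2)]. *)
Definition surface_coef : nat -> R :=
  let k := (1001 / 1000) ^+ 2 in let m := 2 * k ^+ 2 / 2000 ^+ 2 in
  let x := 2 / 1000 - 2 / (150 * 1000) in let y := 1 / 25 in let z := 4 / 100 in
  let w := x * 1000 ^+ 2 + y * 1000 + z in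
  nth 0 [:: m * (z * w); m * (y * w - y * z); m * (x * w - y ^+ 2 - x * z);
    - (m * (2 * x * y)); - (m * x ^+ 2)].

(** This integrand bounds twice the product of the two tail probabilities. The denominator 2000 is
    twice the area of the triangle, a lower bound for the total surface in units of [c]. *)
Lemma surface_bound_poly (u : R) :
  2 * (surface_bound 0 u / 2000 * (surface_bound u 1000 / 2000)) =
  \sum_(i < 5) surface_coef i * u ^+ i.
Proof.
rewrite !big_ord_recr big_ord0 /= /surface_bound /surface_coef/=.
by field.
Qed.

Lemma hausdorff2_surface_slab (c a b : R) : 0 <= c ->
    (forall A, measurable A -> hausdorff_plane A = (c%:E * lebesgue2 A)%E) ->
    0 <= a -> a <= b -> b <= 1000 ->
  (hausdorff2 (surf `&` [set p | (a <= p.1.1 <= b)%R]) <= (c * surface_bound a b)%:E)%E.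
Proof.
move=> c0 cE a0 ab b1; apply: le_trans (hausdorff2_surface_le a b) _.
rewrite !cE; [|exact: measurable_sym_strip (measurable_cst _)
  |exact: measurable_sym_strip measurable_half_thickness
  |exact: measurable_sym_strip measurable_half_width].
rewrite lebesgue2_width_strip// lebesgue2_thickness_strip// lebesgue2_cap.
have collect (k x y z : R) : (k%:E * (c%:E * x%:E + c%:E * x%:E + (c%:E * y%:E + c%:E * y%:E) +
    c%:E * z%:E) = (c * (k * (2 * x + 2 * y + z)))%:E)%E.
  transitivity (k * (c * x + c * x + (c * y + c * y) + c * z))%:E; first by [].
  by congr EFin; ring.
by rewrite collect.
Qed.

Lemma theta_le (K : convex_body R) : body K = Kset 1000 (1 / 100) -> (theta K <= (2805 / 10)%:E)%E.
Proof.
move=> KE; rewrite /theta.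
move: (measurable_boundary K); rewrite KE => msurf.
(* The law is then carried by a single point, on which the zero function bounds the distance. *)
have [degenerate|] := boolP ((hausdorff2 surf == 0%E) || (hausdorff2 surf == +oo%E)).
  have P1 : uniform_on (@hausdorff2 R) msurf [set point] = 1%E.
    by rewrite uniform_on_degenerate// diracE mem_set.
  apply: (@le_trans _ _ 0%E); last by rewrite lee_fin; lra.
  apply: le_trans (mean_distance_le (g := cst 0) _ P1 _ _ _) _.
  - apply: closed_measurable3; apply: accessible_closed_set1.
    exact: hausdorff_accessible (@norm_hausdorff _ _).
  - exact: measurable_cst.
  - by move=> z.
  - by move=> p q -> ->; rewrite /edist !subrr expr0n/= !addr0 sqrtr0.
  - by rewrite integral0_eq.
rewrite negb_or => /andP[M0 Moo].
have [M ME] : exists M, hausdorff2 surf = M%:E.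
  exists (fine (hausdorff2 surf)); rewrite fineK// ge0_fin_numE ?ltey//; exact: hausdorff2_ge0.
have M_gt0 : 0 < M by rewrite -lte_fin -ME lt0e M0 hausdorff2_ge0.
have PE := uniform_onE msurf M_gt0 ME.
set P := uniform_on _ _ in PE *.
have := @hausdorff2_surface_ge R; rewrite ME => M_ge.
have zero_le_L : (0 : R) <= 1000 by clear; lra.
have half_gt0 : (0 : R) < 1 / 2 by clear; lra.
have err_ge0 : (0 : R) <= 2 + 2 / 100 by clear; lra.
have mW : measurable (sym_strip 0 1000 wid) := measurable_sym_strip 0 1000 measurable_half_width.
have [c c0 cE] : exists2 c : R, 0 <= c &
    forall A, measurable A -> hausdorff_plane A = (c%:E * lebesgue2 A)%E.
  apply: (@translation_invariant_measureE R _ (1 / 2) hausdorff_plane_translation_invariant).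
    exact: half_gt0.
  (* Shifted by 500 along the first axis, the square of side 1/2 fits into the triangle, whose
     measure is at most [M]. *)
  have mW' := measurable_preimage (measurable_translate (500, 0)) mW.
  apply: (@le_lt_trans _ _ (hausdorff_plane (translate (500, 0) @^-1` sym_strip 0 1000 wid))).
    apply: le_measure; rewrite ?inE//; first by apply: measurableX; exact: measurable_itv.
    move=> [x y] [] /=; rewrite !in_itv/= => /andP[x0 x1] /andP[y0 y1].
    rewrite /sym_strip /translate/= addr0 (ger0_norm y0) /half_width.
    clear - x0 x1 y1; split; [apply/andP; split|]; lra.
  rewrite hausdorff_plane_translation_invariant//.
  apply: le_lt_trans (ltry M); apply: le_trans M_ge; exact: leeDl.
have surf_slab p : surf p -> 0 <= p.1.1 <= 1000.
  by move=> /boundary_subset_faces[[[]]].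
(* Each large face projects onto a triangle of Lebesgue area 1000. *)
have cM : c * 2000 <= M.
  move: M_ge; rewrite cE// lebesgue2_width_strip// -EFinM -EFinD lee_fin => M_ge.
  apply: le_trans M_ge; rewrite le_eqVlt; apply/orP; left; apply/eqP; by field.
have slab a b := hausdorff2_surface_slab c0 cE (a := a) (b := b).
(* With [c = 0] the upper bound for the slab [[0, 1000]], which is the whole surface, would
   contradict [0 < M]. *)
have c_gt0 : 0 < c.
  rewrite lt0r c0 andbT; apply/eqP => c00.
  have := slab 0 1000 (lexx _) zero_le_L (lexx _).
  rewrite setIidl; last exact: surf_slab.
  by rewrite ME c00 mul0r lee_fin leNgt M_gt0.
(* Here [c] cancels between the upper bound for the slab and the lower bound for [M]. *)
have P_slab a b U : 0 <= a -> a <= b -> b <= 1000 -> (forall p, U p -> surf p -> a <= p.1.1 <= b) ->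
    (P U <= (surface_bound a b / 2000)%:E)%E.
  move=> a0 ab b1 Uab; rewrite PE.
  have Sab := slab a b a0 ab b1.
  have S0 : 0 <= surface_bound a b.
    rewrite -(pmulr_rge0 _ c_gt0) -lee_fin; apply: le_trans Sab; exact: hausdorff2_ge0.
  apply: (@le_trans _ _ ((c * surface_bound a b)%:E * (M^-1)%:E)%E).
    rewrite lee_wpmul2r ?lee_fin ?invr_ge0 ?(ltW M_gt0)//.
    by apply: le_trans Sab; apply: le_hausdorff2 => p [Up sp]; split => //; exact: Uab.
  rewrite -EFinM lee_fin ler_pdivrMr// mulrAC ler_pdivlMr; last by rewrite ltr0n.
  by rewrite mulrAC [leLHS]mulrC ler_wpM2l.
have Psurf U : surf `<=` U -> P U = 1%E.
  move=> sU; rewrite PE setIidr//; transitivity (M%:E * (M^-1)%:E)%E.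
    by congr (_ * _)%E.
  by rewrite -EFinM divff// gt_eqF.
have ms : measurable_fun setT (fun p : space3 R => p.1.1 : R).
  exact: (measurableT_comp measurable_fst measurable_fst).
pose g (z : space3 R * space3 R) : R := `|z.1.1.1 - z.2.1.1|.
have mg : measurable_fun setT g.
  apply: (measurableT_comp (@normr_measurable R setT)).
  exact: (measurable_funB (measurableT_comp ms measurable_fst)
    (measurableT_comp ms measurable_snd)).
(* Two points of the surface differ by at most 2 in the second coordinate and by at most 2/100 in
   the third. *)
apply: le_trans (mean_distance_le (g := fun z => g z + (2 + 2 / 100)) msurf (Psurf _ _) _ _ _) _.
- by [].
- exact: measurable_funD.
- by move=> z; apply: addr_ge0; [exact: normr_ge0|exact: err_ge0].
- move=> p q /boundary_subset_faces[[[/andP[p0 p1] px] py] _].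
  move=> /boundary_subset_faces[[[/andP[q0 q1] qx] qy] _].
  have x2 : `|p.1.2 - q.1.2| <= 2.
    apply: le_trans (ler_normB _ _) _.
    move: px qx; rewrite /half_width => px qx; clear - p1 q1 px qx; lra.
  have y2 : `|p.2 - q.2| <= 2 / 100.
    apply: le_trans (ler_normB _ _) _; move: py qy; rewrite /half_thickness => py qy.
    clear - p0 q0 py qy; lra.
  apply: le_trans (edist_le_sum p q) _; rewrite /g/=.
  clear - x2 y2; lra.
under eq_integral do rewrite EFinD.
rewrite ge0_integralD; last 5 first.
- exact: measurableT.
- by move=> z _; rewrite lee_fin /g.
- exact/measurable_EFinP.
- by move=> z _; rewrite lee_fin; exact: err_ge0.
- exact: measurable_cst.
have PP1 : (P \x P)%E setT = 1%E.
  rewrite -setXTT product_measure1E//; transitivity (P setT * P setT)%E; first by [].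
  by rewrite probability_setT mule1.
rewrite integral_cst; last exact: measurableT.
rewrite [X in (_ * X)%E]PP1 mule1 /g.
rewrite (@integral_cdf_abs_sub_itv _ _ _ P _ 0 1000 ms); last first.
  by apply: Psurf => p /surf_slab/andP[].
apply: (@le_trans _ _ (\int[lebesgue_measure]_(u in `[0%R, 1000%R])
    (2 * (surface_bound 0 u / 2000 * (surface_bound u 1000 / 2000)))%:E + (2 + 2 / 100)%:E)%E).
  rewrite leeD2r//; apply: ge0_le_integral.
  - exact: measurable_itv.
  - by move=> u _; rewrite adde_ge0// mule_ge0.
  - have [mle mlt] := measurable_cdf P ms.
    apply: measurable_funTS; apply: emeasurable_funD; exact: emeasurable_funM.
  - by apply/measurable_EFinP; apply: measurable_funTS; apply: measurable_polyE surface_bound_poly.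
  - move=> u; rewrite /= in_itv/= => u01; have [u0 u1] := andP u01.
    have low : (P [set p : space3 R | (p.1.1 <= u)%R] <= (surface_bound 0 u / 2000)%:E)%E.
      by apply: P_slab => // p /= pu /surf_slab/andP[-> _].
    have high : (P [set p : space3 R | (u < p.1.1)%R] <= (surface_bound u 1000 / 2000)%:E)%E.
      by apply: P_slab => // p /= pu /surf_slab/andP[_ ->]; rewrite ltW.
    rewrite mulr_natl mulr2n EFinD EFinM; apply: leeD; last rewrite muleC.
      by apply: lee_pmul => //; exact: measure_ge0.
    by apply: lee_pmul => //; exact: measure_ge0.
(* The integral is about 277.65, so with the error term the total is about 279.7. *)
rewrite (integral_itv_poly zero_le_L surface_bound_poly) -EFinD lee_fin.
rewrite !big_ord_recr big_ord0 /= /surface_coef/=.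
clear; lra.
Qed.

End theta_bound.

(** * The volume side *)

Section Delta_bound.
Context {R : realType}.
Local Notation wid := (@half_width R).
Local Notation thk := (@half_thickness R).

(** With t = u / 1000, the cross-section area is proportional to t (1 - 2 t / 3); this is its
    primitive, normalised to 1 at t = 1. *)
Definition volume_cdf (u : R) : R := 9 / 5 * (u / 1000) ^+ 2 - 4 / 5 * (u / 1000) ^+ 3.

Lemma lebesgue3_wedge (u : R) : 0 <= u <= 1000 ->
  lebesgue3 (sym_wedge 0 u wid thk) = (100 / 9 * volume_cdf u)%:E.
Proof.
move=> /andP[u0 u1]; rewrite lebesgue3_sym_wedge; first last.
- by move=> x /andP[_ xu]; rewrite /half_thickness; lra.
- by move=> x /andP[x0 _]; rewrite /half_width; lra.
- exact: measurable_half_thickness.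
- exact: measurable_half_width.
rewrite (@integral_itv_poly _ _
  (nth 0 [:: 0; 4 / 1000 / 100; - (4 / 1000 / (150 * 1000))]) 3 _ _ u0); last first.
  by move=> x; rewrite !big_ord_recr big_ord0 /= /half_width /half_thickness; field.
rewrite !big_ord_recr big_ord0 /= /volume_cdf; congr EFin.
by field.
Qed.

(** Coefficients of 2 F (1 - F) for F = a u^2 - b u^3. *)
Definition volume_coef : nat -> R :=
  let a := 9 / 5 / 1000 ^+ 2 in let b := 4 / 5 / 1000 ^+ 3 in
  nth 0 [:: 0; 0; 2 * a; - 2 * b; - 2 * a ^+ 2; 4 * a * b; - 2 * b ^+ 2].

Lemma volume_cdf_poly (u : R) :
  2 * (volume_cdf u * (1 - volume_cdf u)) = \sum_(i < 7) volume_coef i * u ^+ i.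
Proof.
rewrite !big_ord_recr big_ord0 /= /volume_cdf /volume_coef/=.
by field.
Qed.

(** The law of the first coordinate is explicit, so its mean absolute difference is computed
    exactly; it bounds the mean distance from below. *)
Lemma Delta_ge (K : convex_body R) : body K = Kset 1000 (1 / 100) -> (281%:E <= Delta K)%E.
Proof.
move=> KE; rewrite /Delta.
move: (measurable_body K); rewrite KE Kset_wedge => mK.
have zero_le_L : (0 : R) <= 1000 by lra.
have V_gt0 : (0 : R) < 100 / 9 by lra.
have VE : lebesgue3 (sym_wedge 0 1000 wid thk) = (100 / 9)%:E.
  rewrite lebesgue3_wedge; last by rewrite zero_le_L lexx.
  by rewrite /volume_cdf; congr EFin; field.
have PE := uniform_onE mK V_gt0 VE.
set P := uniform_on _ _ in PE *.
have ms : measurable_fun setT (fun p : space3 R => p.1.1 : R).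
  exact: (measurableT_comp measurable_fst measurable_fst).
have Ple u : 0 <= u <= 1000 -> P [set p | p.1.1 <= u] = (volume_cdf u)%:E.
  move=> u01; have [u0 u1] := andP u01.
  rewrite PE; transitivity (lebesgue3 (sym_wedge 0 u wid thk) * ((100 / 9)^-1)%:E)%E.
    congr (lebesgue3 _ * _)%E; apply/seteqP; split => p.
      by move=> [/= pu [[/andP[p0 _] pw] pt]]; split => //; split => //; rewrite p0.
    move=> [[/andP[p0 pu] pw] pt]; split => //; split => //; split => //.
    by rewrite p0 (le_trans pu u1).
  rewrite lebesgue3_wedge// -EFinM; congr EFin.
  by rewrite mulrAC divff ?mul1r// gt_eqF.
have Pgt u : 0 <= u <= 1000 -> P [set p | u < p.1.1] = (1 - volume_cdf u)%:E.
  move=> u01; rewrite (_ : [set _ | _] = ~` [set p | p.1.1 <= u]); last first.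
    by apply/seteqP; split => p /=; [rewrite ltNge => /negP|move=> /negP; rewrite ltNge].
  rewrite probability_setC; last exact: (measurable_le ms (measurable_cst u)).
  by rewrite EFinB -Ple.
apply: le_trans (le_mean_distance P).
rewrite (@integral_cdf_abs_sub_itv _ _ _ P _ 0 1000 ms); last first.
  rewrite PE setIidr; last by move=> p [[/andP[p0 p1] _] _].
  transitivity ((100 / 9)%:E * ((100 / 9)^-1)%:E : \bar R)%E; first by congr (_ * _)%E.
  by rewrite -EFinM divff// gt_eqF.
rewrite (eq_integral (fun u : measurableTypeR R =>
    (2 * (volume_cdf u * (1 - volume_cdf u)))%:E)); last first.
  move=> u; rewrite inE/= in_itv/= => u01; rewrite Ple// Pgt// -!EFinM -EFinD.
  by congr EFin; ring.
(* The integral equals 1968/7, slightly more than 281. *)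
rewrite (integral_itv_poly zero_le_L volume_cdf_poly) lee_fin.
rewrite !big_ord_recr big_ord0 /= /volume_coef/=.
clear; lra.
Qed.

End Delta_bound.

(** * Comparison of the two bounds *)

Unset Implicit Arguments.

Theorem theorem4p3 (R : realType) (L eps : R) (L_gt0 : 0 < L) (eps_gt0 : 0 < eps) :
  L = 1000 -> eps = 1 / 100 ->
  (Delta (K_body L_gt0 eps_gt0) > theta (K_body L_gt0 eps_gt0))%E.
Proof.
move=> LE epsE; subst L eps.
apply: (@lt_le_trans _ _ 281%:E); last exact: Delta_ge.
apply: (@le_lt_trans _ _ (2805 / 10)%:E); first exact: theta_le.
by rewrite lte_fin; lra.
Qed.
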